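(* Every book representation of $K_6$ with sheet number four is equivalent either to the book representation with sheet 1: $\{13,14,46\}$; sheet 2: $\{15,24\}$; sheet 3: $\{26,36\}$; sheet 4: $\{25,35\}$; or to its mirror image.
   Context: Let $C$ be a circle in a plane in $\mathbb{R}^3\subset S^3$ with six equally spaced vertices on it labelled $1,\dots,6$ clockwise. For $a<b$, $ab$ denotes the edge joining $a$ and $b$. Two edges intersect if the corresponding chords of $C$ cross in the interior of the disk bounded by $C$ (four distinct endpoints alternating around $C$). A book representation of $K_6$ on $s$ sheets is a spatial embedding of $K_6$ in which the vertices are the six equally spaced points of $C$ labelled $1,\dots,6$ clockwise and the edges are distributed among $s$ sheets, numbered $1$ (top) to $s$ (bottom). The sheets are topological disks with common boundary $C$ and pairwise disjoint interiors, stacked in order. Each edge lies in one sheet and projects to its chord in the plane of $C$, and edges in the same sheet do not intersect. Exterior edges (joining consecutive vertices on $C$) intersect no other edge and may be placed in any sheet. Hence a book representation is specified by listing, for each of the ordered sheets, the interior edges it contains (the interior edges are $13,14,15,24,25,26,35,36,46$), subject to edges in the same sheet not intersecting. Two book representations are equivalent if they are ambient isotopic as spatial graphs in $S^3$ (vertex labels need not be preserved). The sheet number of a book representation is the minimum number of sheets used by any book representation equivalent to it. The mirror image of a book representation is obtained by reflecting through the plane of $C$, i.e. by reversing the order of the sheets. *)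

(* Defs.v *)
From HB Require Import structures.
From mathcomp Require Import all_boot all_order all_algebra all_fingroup.
From mathcomp Require Import all_classical all_reals all_analysis.
Set Implicit Arguments.
Unset Strict Implicit.
Unset Printing Implicit Defensive.
Import Order.TTheory GRing.Theory Num.Theory.
Import numFieldNormedType.Exports.
Local Open Scope classical_set_scope.
Local Open Scope ring_scope.

(** Coordinates: the plane of C is [R * R], space is [R * R * R] with the plane
    of C as [z = 0] (so [fst] is the projection to that plane), and S^3 is
    space together with the point at infinity [None].  C is the unit circle. *)
Notation space R := (R * R * R)%type.
Notation S3 R := (one_point_compactification (space R)).

Definition circle (R : realType) : set (R * R) :=
  [set p | p.1 ^+ 2 + p.2 ^+ 2 = 1].

Definition open_disk (R : realType) : set (R * R) :=
  [set p | p.1 ^+ 2 + p.2 ^+ 2 < 1].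

Definition closed_disk (R : realType) : set (R * R) :=
  [set p | p.1 ^+ 2 + p.2 ^+ 2 <= 1].

(** The vertex labelled [i + 1]; the sign makes the labels increase clockwise
    when seen from the side [z > 0]. *)
Definition plane_vertex (R : realType) (i : 'I_6) : R * R :=
  (cos (2 * pi * i%:R / 6), - sin (2 * pi * i%:R / 6)).

Definition chord (R : realType) (a b : 'I_6) : set (R * R) :=
  [set (1 - t) *: plane_vertex R a + t *: plane_vertex R b | t in `[0, 1]].

Definition between (a b c : 'I_6) : bool := (minn a b < c < maxn a b)%N.

(** The edges [ab] and [cd] intersect: four distinct endpoints that alternate
    around C. *)
Definition edges_cross (a b c d : 'I_6) : bool :=
  uniq [:: a; b; c; d] && (between a b c (+) between a b d).

Definition exterior (a b : 'I_6) : bool := (ordS a == b) || (ordS b == a).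

(** The sheets are the graphs over the closed disk of the functions [height k];
    [k = 0] is the top sheet.  The edge [ab] lies in the sheet [page a b]; the
    values [page a a] play no role, and sheets without edges are allowed. *)
Record book (R : realType) (s : nat) := Book {
  height : 'I_s -> R * R -> R;
  page : 'I_6 -> 'I_6 -> 'I_s;
  height_continuous : forall k, {within @closed_disk R, continuous (height k)};
  height_circle : forall k p, circle p -> height k p = 0;
  height_stacked : forall (k l : 'I_s) p,
    (k < l)%N -> open_disk p -> height l p < height k p;
  page_sym : forall a b, page a b = page b a;
  page_cross : forall a b c d, edges_cross a b c d -> page a b != page c d }.

Record spatial_K6 (R : realType) := SpatialK6 {
  vertex : 'I_6 -> S3 R;
  edge : 'I_6 -> 'I_6 -> set (S3 R) }.

(** That the edges meet only in common endpoints follows from [height_stacked]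
    and [page_cross]. *)
Definition book_graph (R : realType) (s : nat) (B : book R s) : spatial_K6 R :=
  {| vertex := fun i => Some (plane_vertex R i, 0);
     edge := fun a b => [set Some (p, height B (page B a b) p)
                          | p in @chord R a b] |}.

Definition homeomorphism (T U : topologicalType) (h : T -> U) : Prop :=
  continuous h /\
  exists g : U -> T, [/\ continuous g, cancel h g & cancel g h].

Definition ambient_isotopy (R : realType) (H : R -> S3 R -> S3 R) : Prop :=
  [/\ {within `[0, 1]%classic `*` [set: S3 R],
        continuous (fun tx : R * S3 R => H tx.1 tx.2)},
      forall t, 0 <= t <= 1 -> homeomorphism (H t)
    & forall x, H 0 x = x].

(** The vertex labels may be permuted by [sigma]. *)
Definition ambient_isotopic (R : realType) (G G' : spatial_K6 R) : Prop :=
  exists (H : R -> S3 R -> S3 R) (sigma : {perm 'I_6}),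
    [/\ ambient_isotopy H,
        forall i, H 1 (vertex G i) = vertex G' (sigma i)
      & forall a b, a != b ->
          H 1 @` edge G a b = edge G' (sigma a) (sigma b)].

Definition book_equiv (R : realType) (s s' : nat)
    (B : book R s) (B' : book R s') : Prop :=
  ambient_isotopic (book_graph B) (book_graph B').

Definition has_sheet_number (R : realType) (s : nat) (B : book R s) (n : nat)
    : Prop :=
  (exists B' : book R n, book_equiv B B') /\
  (forall (m : nat) (B' : book R m), book_equiv B B' -> (n <= m)%N).

Section Mirror.
Variables (R : realType) (s : nat) (B : book R s).

Let mheight (k : 'I_s) (p : R * R) : R := - height B (rev_ord k) p.
Let mpage (a b : 'I_6) : 'I_s := rev_ord (page B a b).

Let mheight_continuous k : {within @closed_disk R, continuous (mheight k)}.
Proof.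
move=> p; apply: (@continuousN _ _ (subspace (@closed_disk R))).
exact: height_continuous.
Qed.

Let mheight_circle k p : circle p -> mheight k p = 0.
Proof. by move=> Cp; rewrite /mheight height_circle ?oppr0. Qed.

Let mheight_stacked (k l : 'I_s) p :
  (k < l)%N -> open_disk p -> mheight l p < mheight k p.
Proof.
move=> kl Dp; rewrite /mheight ltrN2; apply: height_stacked => //=.
by rewrite ltn_sub2l // (leq_ltn_trans kl).
Qed.

Let mpage_sym a b : mpage a b = mpage b a.
Proof. by rewrite /mpage page_sym. Qed.

Let mpage_cross a b c d : edges_cross a b c d -> mpage a b != mpage c d.
Proof. by move=> /(page_cross B); rewrite (inj_eq rev_ord_inj). Qed.

(** Reflection in the plane of C, which reverses the order of the sheets. *)
Definition mirror : book R s :=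
  Book mheight_continuous mheight_circle mheight_stacked mpage_sym mpage_cross.

End Mirror.

(** [ab] is encoded as the pair of labels [(a, b)], [1 <= a < b <= 6]. *)
Definition interior_edges (R : realType) (s : nat) (B : book R s) (k : 'I_s)
    : seq (nat * nat) :=
  [seq (e.1.+1, e.2.+1) |
    e : 'I_6 * 'I_6 <- enum {: 'I_6 * 'I_6} &
      [&& (e.1 < e.2)%N, ~~ exterior e.1 e.2 & page B e.1 e.2 == k]].

Definition has_sheets (R : realType) (s : nat) (B : book R s)
    (L : seq (seq (nat * nat))) : Prop :=
  size L = s /\ forall k : 'I_s, interior_edges B k =i nth [::] L k.

Section Paraboloids.
Variables (R : realType) (s : nat) (page : 'I_6 -> 'I_6 -> 'I_s).
Hypothesis page_sym : forall a b, page a b = page b a.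
Hypothesis page_cross : forall a b c d,
  edges_cross a b c d -> page a b != page c d.

Let pheight (k : 'I_s) (p : R * R) : R :=
  - k%:R * (1 - (p.1 ^+ 2 + p.2 ^+ 2)).

Let pheight_continuous k : {within @closed_disk R, continuous (pheight k)}.
Proof.
apply: continuous_subspaceT => p; apply: cvgM; first exact: cvg_cst.
apply: cvgB; first exact: cvg_cst.
by apply: cvgD; rewrite expr2; apply: cvgM;
  [exact: cvg_fst | exact: cvg_fst | exact: cvg_snd | exact: cvg_snd].
Qed.

Let pheight_circle k p : circle p -> pheight k p = 0.
Proof. by rewrite /circle/= /pheight => ->; rewrite subrr mulr0. Qed.

Let pheight_stacked (k l : 'I_s) p :
  (k < l)%N -> open_disk p -> pheight l p < pheight k p.
Proof.
rewrite /open_disk/= /pheight => kl Dp.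
by rewrite ltr_pM2r ?subr_gt0// ltrN2 ltr_nat.
Qed.

Definition paraboloid_book : book R s :=
  Book pheight_continuous pheight_circle pheight_stacked page_sym page_cross.

End Paraboloids.

Definition four_sheets : seq (seq (nat * nat)) :=
  [:: [:: (1, 3); (1, 4); (4, 6)];
      [:: (1, 5); (2, 4)];
      [:: (2, 6); (3, 6)];
      [:: (2, 5); (3, 5)]]%N.

(** The exterior edges, which [four_sheets] does not list, go to the top sheet. *)
Definition four_page_nat (a b : nat) : nat :=
  (find (fun l => ((minn a b).+1, (maxn a b).+1) \in l) four_sheets %% 4)%N.

Definition four_page (a b : 'I_6) : 'I_4 := inord (four_page_nat a b).

Lemma four_pageE a b : four_page a b = four_page_nat a b :> nat.
Proof. by rewrite inordK// ltn_mod. Qed.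

Lemma four_page_sym a b : four_page a b = four_page b a.
Proof. by rewrite /four_page /four_page_nat minnC maxnC. Qed.

Lemma four_page_cross a b c d :
  edges_cross a b c d -> four_page a b != four_page c d.
Proof.
pose btw a b c := (minn a b < c < maxn a b)%N.
have H : all (fun a => all (fun b => all (fun c => all (fun d =>
    uniq [:: a; b; c; d] && (btw a b c (+) btw a b d) ==>
    (four_page_nat a b != four_page_nat c d))
  (iota 0 6)) (iota 0 6)) (iota 0 6)) (iota 0 6) by vm_compute.
have ord6 (i : 'I_6) : val i \in iota 0 6 by rewrite mem_iota /=.
rewrite -val_eqE /= !four_pageE /edges_cross -(map_inj_uniq val_inj).
move/allP/(_ _ (ord6 a))/allP/(_ _ (ord6 b))/allP/(_ _ (ord6 c)): H.
by move/allP/(_ _ (ord6 d))/implyP.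
Qed.

Lemma four_sheets_book (R : realType) :
  exists T : book R 4, has_sheets T four_sheets.
Proof.
exists (paraboloid_book R four_page_sym four_page_cross); split=> // k [x y].
pose ext a b := (a.+1 %% 6 == b)%N || (b.+1 %% 6 == a)%N.
have ord6 (i : 'I_6) : val i \in iota 0 6 by rewrite mem_iota /=.
apply/mapP/idP.
  case=> -[a b]; rewrite mem_filter mem_enum andbT => /and3P[/= ab eab].
  rewrite -val_eqE /= four_pageE => /eqP <- [-> ->].
  have H : all (fun a => all (fun b => (a < b)%N ==> ~~ ext a b ==>
      ((a.+1, b.+1) \in nth [::] four_sheets (four_page_nat a b)))
    (iota 0 6)) (iota 0 6) by vm_compute.
  move/allP/(_ _ (ord6 a))/allP/(_ _ (ord6 b)): H.
  by move=> /implyP/(_ ab)/implyP; apply; exact: eab.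
have H : all (fun k => all (fun e : nat * nat =>
    [&& (0 < e.1)%N, (e.1.-1 < e.2.-1 < 6)%N, ~~ ext e.1.-1 e.2.-1 &
        four_page_nat e.1.-1 e.2.-1 == k])
  (nth [::] four_sheets k)) (iota 0 4) by vm_compute.
have /allP/(_ k) := H; rewrite mem_iota => /(_ (ltn_ord k))/allP Hk /Hk.
case: x y {Hk} => [|x] [|y] //=.
case/and3P=> /andP[xy y6] exy pxy.
exists (Ordinal (ltn_trans xy y6), Ordinal y6) => //.
rewrite mem_filter mem_enum andbT /= xy -val_eqE /= four_pageE pxy andbT.
exact: exy.
Qed.

(* Main.v *)
Require Import Defs.
From HB Require Import structures.
From mathcomp Require Import all_boot all_order all_algebra all_fingroup.
From mathcomp Require Import all_classical all_reals all_analysis.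
From mathcomp Require Import ring lra.
Set Implicit Arguments.
Unset Strict Implicit.
Unset Printing Implicit Defensive.
Import Order.TTheory GRing.Theory Num.Theory.
Import numFieldNormedType.Exports.
Local Open Scope classical_set_scope.
Local Open Scope ring_scope.

(** Replace the book by an equivalent one on four sheets. The shape of the sheets is immaterial
    ([stack_graph_over], [book_level_graph]): each edge may be placed at a constant level times
    [beta], the function that is [1 - |p|^2] on the disk and 0 outside. Moreover only the order of
    the levels of crossing diagonals matters ([same_order_isotopic]). So, up to isotopy, a book is
    an acyclic orientation of the graph whose vertices are the nine diagonals and whose edges are
    the fifteen crossings.

    Three moves relate different orientations. The rotation of the hexagon permutes the diagonals
    ([rotate_level_graph]). Turning the open book with binding C by half a turn carries the top page
    through infinity to the bottom ([top_to_bottom]), so a diagonal lying above all those it crosses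
    may be put below them all ([flip_list_graph]): a source of the orientation becomes a sink.
    Finally, if the star of vertex 5 lies above everything it crosses and that of vertex 6 below, or
    conversely, the two vertices can be interchanged by an isotopy of space ([star_exchange]).

    In a connected graph each class of acyclic orientations under flips contains exactly one whose
    only source is a prescribed vertex, so flipping every source other than the diagonal 14 gives a
    normal form [nf]. A finite computation ([all_colorings_reduce]) shows that every assignment of
    the diagonals to four levels has the normal form of a rotated target or of a rotated star
    configuration, and after one star exchange the latter also reduce to targets
    ([exchanged_stars_reduce]). Uniqueness and termination of normal forms enter only as a guide:
    every flip is an isotopy, and the computation compares the results directly.

    There are four targets. Two of them use three levels and would give a book on three sheets,
    against minimality ([three_levels_book]); the others are the listed book and its mirror
    image. *)

(** * Maps into compact Hausdorff spaces, and rules for continuity *)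

(** A continuous injection from a compact space to a Hausdorff space is closed, hence an embedding.
    This yields continuity of inverse maps without any formula for them. *)
Lemma continuous_lift (X K Y : topologicalType) (f : X -> K) (psi : K -> Y) :
  compact [set: K] -> hausdorff_space Y -> continuous psi -> injective psi ->
  continuous (psi \o f) -> continuous f.
Proof.
move=> cK hY cpsi ipsi cf x U /=.
rewrite [in X in X -> _]nbhsE => -[V [oV Vfx] VU].
have cVc : compact (psi @` (~` V)).
  apply: continuous_compact; first exact: continuous_subspaceT.
  by rewrite -[~` V]setTI; apply: compact_closedI => //; apply: open_closedC.
have oW : open (~` (psi @` (~` V))) by apply: closed_openC; exact: compact_closed.
have : nbhs x ((psi \o f) @^-1` (~` (psi @` (~` V)))).
  apply: cf; apply: open_nbhs_nbhs; split => //= -[y nVy /ipsi yfx].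
  by apply: nVy; rewrite yfx.
apply: filterS => y /= nVy; apply: VU; apply: contrapT => nV.
by apply: nVy; exists (f y).
Qed.

Lemma bijective_homeomorphism (K : topologicalType) (h : K -> K) :
  compact [set: K] -> hausdorff_space K -> continuous h -> bijective h ->
  homeomorphism h.
Proof.
move=> cK hK ch [g hg gh]; split => //; exists g; split => //.
apply: (continuous_lift cK hK ch (can_inj hg)) => x.
rewrite (_ : h \o g = id); first exact: cvg_id.
by apply/funext => y /=; rewrite gh.
Qed.

Lemma subspace_continuous_comp (S T U : topologicalType) (A : set S) (B : set T)
    (f : S -> T) (g : T -> U) :
  (forall x, A x -> B (f x)) ->
  {within A, continuous f} -> {within B, continuous g} ->
  {within A, continuous (g \o f)}.
Proof.
move=> AB /subspace_continuousP cf /subspace_continuousP cg.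
apply/subspace_continuousP => x Ax V /(cg _ (AB _ Ax)) /(cf _ Ax).
rewrite /nbhs/= /within/=; apply: filterS => y BV Ay.
exact: BV Ay (AB _ Ay).
Qed.

Lemma within_continuous_pair (S T U : topologicalType) (A : set S) (f : S -> T)
    (g : S -> U) :
  {within A, continuous f} -> {within A, continuous g} ->
  {within A, continuous (fun x => (f x, g x))}.
Proof. by move=> cf cg x; apply: cvg_pair; [exact: cf|exact: cg]. Qed.

Section continuity.
Variables (R : realType) (T : topologicalType).
Implicit Types f g : T -> R.

Lemma continuous_cst (U : topologicalType) (c : U) : continuous (fun _ : T => c).
Proof. by move=> x; exact: cvg_cst. Qed.

Lemma continuous_id : continuous (fun x : T => x).
Proof. by move=> x; exact: cvg_id. Qed.

Lemma continuous_pair (U V : topologicalType) (f : T -> U) (g : T -> V) :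
  continuous f -> continuous g -> continuous (fun x => (f x, g x)).
Proof. by move=> cf cg x; apply: cvg_pair; [exact: cf|exact: cg]. Qed.

Lemma continuous_fst (U V : topologicalType) (f : T -> U * V) :
  continuous f -> continuous (fun x => (f x).1).
Proof. by move=> cf x; apply: (cvg_comp _ _ (cf x)); exact: cvg_fst. Qed.

Lemma continuous_snd (U V : topologicalType) (f : T -> U * V) :
  continuous f -> continuous (fun x => (f x).2).
Proof. by move=> cf x; apply: (cvg_comp _ _ (cf x)); exact: cvg_snd. Qed.

Lemma continuous_compose (U V : topologicalType) (f : T -> U) (h : U -> V) :
  continuous f -> continuous h -> continuous (fun x => h (f x)).
Proof. by move=> cf ch x; apply: (cvg_comp _ _ (cf x)); exact: ch. Qed.

Lemma continuous_add f g :
  continuous f -> continuous g -> continuous (fun x => f x + g x).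
Proof. by move=> cf cg x; apply: cvgD; [exact: cf|exact: cg]. Qed.

Lemma continuous_opp f : continuous f -> continuous (fun x => - f x).
Proof. by move=> cf x; apply: cvgN; exact: cf. Qed.

Lemma continuous_mul f g :
  continuous f -> continuous g -> continuous (fun x => f x * g x).
Proof. by move=> cf cg x; apply: cvgM; [exact: cf|exact: cg]. Qed.

Lemma continuous_exp f n : continuous f -> continuous (fun x => f x ^+ n).
Proof.
move=> cf; elim: n => [|n IHn]; first exact: continuous_cst.
have -> : (fun x => f x ^+ n.+1) = fun x => f x * f x ^+ n.
  by apply/funext => x; rewrite exprS.
exact: continuous_mul.
Qed.

Lemma continuous_inv f :
  (forall x, f x != 0) -> continuous f -> continuous (fun x => (f x)^-1).
Proof. by move=> f0 cf x; apply: cvgV; [exact: f0|exact: cf]. Qed.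

Lemma continuous_maxr f g :
  continuous f -> continuous g -> continuous (fun x => Num.max (f x) (g x)).
Proof. by move=> cf cg x; apply: continuous_max; [exact: cf|exact: cg]. Qed.

Lemma continuous_minr f g :
  continuous f -> continuous g -> continuous (fun x => Num.min (f x) (g x)).
Proof. by move=> cf cg x; apply: continuous_min; [exact: cf|exact: cg]. Qed.

Lemma continuous_abs f : continuous f -> continuous (fun x => `|f x|).
Proof. by move=> cf x; apply: cvg_norm; exact: cf. Qed.

Lemma continuous_sqrt f : continuous f -> continuous (fun x => Num.sqrt (f x)).
Proof. by move=> cf; apply: continuous_compose cf _; exact: sqrt_continuous. Qed.

End continuity.

Ltac cont := lazymatch goal with
  | |- continuous (fun _ => ?c) => exact: continuous_cst
  | |- continuous fst => exact: (continuous_fst (@continuous_id _))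
  | |- continuous snd => exact: (continuous_snd (@continuous_id _))
  | |- continuous ( *%R ?c) =>
      exact: (continuous_mul (@continuous_cst _ _ c) (@continuous_id _))
  | |- continuous (+%R ?c) =>
      exact: (continuous_add (@continuous_cst _ _ c) (@continuous_id _))
  | |- continuous -%R => exact: (continuous_opp (@continuous_id _))
  | |- continuous (Num.min ?c) =>
      exact: (continuous_minr (@continuous_cst _ _ c) (@continuous_id _))
  | |- continuous (Num.max ?c) =>
      exact: (continuous_maxr (@continuous_cst _ _ c) (@continuous_id _))
  | |- continuous id => exact: continuous_id
  | |- continuous (fun x => x) => exact: continuous_id
  | |- continuous (fun x => (_, _)) => apply: continuous_pair; cont
  | |- continuous (fun x => fst _) => apply: continuous_fst; cont
  | |- continuous (fun x => snd _) => apply: continuous_snd; cont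
  | |- continuous (fun x => _ + _) => apply: continuous_add; cont
  | |- continuous (fun x => _ * _) => apply: continuous_mul; cont
  | |- continuous (fun x => - _) => apply: continuous_opp; cont
  | |- continuous (fun x => _ ^+ _) => apply: continuous_exp; cont
  | |- continuous (fun x => _ ^-1) => apply: continuous_inv; [|cont]
  | |- continuous (fun x => Num.max _ _) => apply: continuous_maxr; cont
  | |- continuous (fun x => Num.min _ _) => apply: continuous_minr; cont
  | |- continuous (fun x => Num.norm _) => apply: continuous_abs; cont
  | |- continuous (fun x => Num.sqrt _) => apply: continuous_sqrt; cont
  | |- _ => idtac
  end.

(** [a] and [b] reparametrise time; this one statement serves both the concatenation and the
    reversal of isotopies. *)
Lemma within_continuous_slide (T X : topologicalType) (I : set T)
    (H K : T -> X -> X) (a b : T -> T) :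
  continuous a -> continuous b ->
  (forall t, I t -> I (a t)) -> (forall t, I t -> I (b t)) ->
  {within I `*` [set: X], continuous (fun tx : T * X => H tx.1 tx.2)} ->
  {within I `*` [set: X], continuous (fun tx : T * X => K tx.1 tx.2)} ->
  {within I `*` [set: X], continuous (fun tx : T * X => K (a tx.1) (H (b tx.1) tx.2))}.
Proof.
move=> ca cb Ia Ib cH cK.
pose f (tx : T * X) := (b tx.1, tx.2); pose g (tx : T * X) := H tx.1 tx.2.
pose f' (tx : T * X) := (a tx.1, g (f tx)).
pose g' (tx : T * X) := K tx.1 tx.2.
have cgf : {within I `*` [set: X], continuous (g \o f)}.
  apply: subspace_continuous_comp cH; first by move=> [t x] [/= It _]; split; last by []; exact: Ib.
  apply: continuous_subspaceT; apply: continuous_pair; last by cont.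
  exact: (continuous_compose (continuous_fst (@continuous_id _)) cb).
apply: (@subspace_continuous_comp _ _ _ _ (I `*` [set: X]) f' g') => //.
  by move=> [t x] [/= It _]; split; last by []; exact: Ia.
apply: within_continuous_pair cgf; apply: continuous_subspaceT.
exact: (continuous_compose (continuous_fst (@continuous_id _)) ca).
Qed.

(** * Ambient isotopies of the 3-sphere; equivalence is symmetric and transitive *)

Section isotopies.
Variable R : realType.
Local Notation S3 := (one_point_compactification (R * R * R)).
Local Notation space := (R * R * R)%type.

Definition box (r : R) : set space :=
  (`[- r, r]%classic `*` `[- r, r]%classic) `*` `[- r, r]%classic.

Lemma box_compact r : compact (box r).
Proof. by do 2?apply: compact_setX; exact: segment_compact. Qed.

Lemma space_hausdorff : hausdorff_space space.
Proof. exact: norm_hausdorff. Qed.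

Lemma box_closed r : closed (box r).
Proof. by apply: compact_closed; [exact: space_hausdorff|exact: box_compact]. Qed.

Lemma in_box r (q : space) : box r q <-> `|q| <= r.
Proof.
case: q => -[x y] z; rewrite /box /= !in_itv /= !prod_normE /= !ge_max !ler_norml.
by split=> [[[-> ->] ->]//|/andP[/andP[-> ->] ->]].
Qed.

Lemma S3_compact : compact [set: S3].
Proof. exact: one_point_compactification_compact. Qed.

Lemma space_locally_compact : locally_compact [set: space].
Proof.
move=> q _; rewrite withinET; exists (box (`|q| + 1)); last first.
  by split; [exact: box_compact|exact: box_closed].
have : nbhs q (ball q 1) by exact: nbhsx_ballx.
apply: filterS => x; rewrite -ball_normE /= => qx; apply/in_box.
by rewrite -[x](subrK q) (le_trans (ler_normD _ _))// addrC lerD2l distrC ltW.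
Qed.

Lemma S3_hausdorff : hausdorff_space S3.
Proof.
apply: one_point_compactification_hausdorff; last exact: space_hausdorff.
exact: space_locally_compact.
Qed.

Lemma bijective_ambient_isotopy (H : R -> S3 -> S3) :
  {within `[0, 1]%classic `*` [set: S3],
     continuous (fun tx : R * S3 => H tx.1 tx.2)} ->
  (forall t, 0 <= t <= 1 -> bijective (H t)) -> (forall x, H 0 x = x) ->
  ambient_isotopy H.
Proof.
move=> cH bH H0; split => // t t01.
apply: bijective_homeomorphism; [exact: S3_compact|exact: S3_hausdorff| |exact: bH].
apply/continuous_subspace_setT.
apply: (@subspace_continuous_comp S3 (R * S3)%type S3 setT (`[0, 1]%classic `*` [set: S3])
  (pair t) (fun tx : R * S3 => H tx.1 tx.2)) => //.
apply: continuous_subspaceT.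
exact: (continuous_pair (@continuous_cst _ _ t) (@continuous_id _)).
Qed.

Definition isotopic_id (h : S3 -> S3) :=
  exists2 H : R -> S3 -> S3, ambient_isotopy H & H 1 = h.

Lemma homeomorphism_bij (h : S3 -> S3) : homeomorphism h -> bijective h.
Proof. by case=> _ [g [_ hg gh]]; exists g. Qed.

Lemma ambient_isotopy_bij (H : R -> S3 -> S3) t :
  ambient_isotopy H -> 0 <= t <= 1 -> bijective (H t).
Proof. by case=> _ hH _ /hH /homeomorphism_bij. Qed.

Lemma isotopic_id_comp h k :
  isotopic_id h -> isotopic_id k -> isotopic_id (k \o h).
Proof.
move=> [H iH <-] [K iK <-]; have [cH _ H0] := iH; have [cK _ K0] := iK.
have min01 (t : R) : 0 <= t <= 1 -> 0 <= Num.min 1 (2 * t) <= 1.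
  by move=> /andP[t0 t1]; rewrite le_min ge_min lexx ler01/= mulr_ge0.
have max01 (t : R) : 0 <= t <= 1 -> 0 <= Num.max 0 (2 * t - 1) <= 1.
  by move=> /andP[t0 t1]; rewrite ge_max le_max lexx ler01/=; lra.
(* Run [H] during the first half and [K] during the second. With clipped times this is a plain
   composite, so nothing has to be pasted at time 1/2. *)
exists (fun t => K (Num.max 0 (2 * t - 1)) \o H (Num.min 1 (2 * t))); last first.
  by congr (K _ \o H _); rewrite ?maxEle ?minEle; case: ifP => //; lra.
apply: bijective_ambient_isotopy.
- have := @within_continuous_slide R S3 `[0, 1]%classic H K
    (fun t => Num.max 0 (2 * t - 1)) (fun t => Num.min 1 (2 * t)).
  apply => //.
  + cont.
  + cont.
- by move=> t t01; apply: bij_comp; apply: ambient_isotopy_bij => //;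
    [exact: max01|exact: min01].
- move=> x /=; rewrite mulr0 sub0r minEle maxEle ifF; last lra.
  by rewrite ifF ?H0 ?K0//; lra.
Qed.

Lemma isotopic_id_inv h g : isotopic_id h -> cancel h g -> isotopic_id g.
Proof.
move=> [H iH <-] hg; have [cH _ H0] := iH.
have b1 : bijective (H 1) by apply: ambient_isotopy_bij => //; rewrite ler01 lexx.
have gh : cancel g (H 1) by apply/(bij_can_sym b1).
have gb : bijective g by exists (H 1).
(* Run [H] backwards, starting from its end map. *)
exists (fun t => H (1 - t) \o g); last by apply/funext => x /=; rewrite subrr H0.
have [_ hH _] := iH.
have cg : continuous g.
  apply: (continuous_lift S3_compact S3_hausdorff (psi := H 1)).
  - by have [] := hH 1 _; rewrite ?ler01 ?lexx.
  - exact: can_inj hg.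
  - rewrite (_ : _ \o _ = id); first by move=> x; exact: cvg_id.
    by apply/funext => y /=; rewrite gh.
apply: bijective_ambient_isotopy.
- have := @within_continuous_slide R S3 `[0, 1]%classic (fun=> g) H
    (fun t => 1 - t) id.
  apply => //.
  + cont.
  + exact: continuous_id.
  + by move=> t; rewrite /mkset !in_itv /=; lra.
  + apply: continuous_subspaceT.
    exact: (continuous_compose (continuous_snd (@continuous_id _)) cg).
- by move=> t t01; apply: bij_comp => //; apply: ambient_isotopy_bij => //; lra.
- by move=> x /=; rewrite subr0 gh.
Qed.

Implicit Types G : spatial_K6 R.

Definition carries (h : S3 -> S3) (sigma : {perm 'I_6}) (G G' : spatial_K6 R) :=
  (forall i, h (vertex G i) = vertex G' (sigma i)) /\
  (forall a b, a != b -> h @` edge G a b = edge G' (sigma a) (sigma b)).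

Lemma ambient_isotopicP G G' : ambient_isotopic G G' <->
  exists h sigma, isotopic_id h /\ carries h sigma G G'.
Proof.
split=> [[H [sigma [iH Hv He]]]|[h [sigma [[H iH <-] [Hv He]]]]].
  by exists (H 1), sigma; split => //; exists H.
by exists H, sigma.
Qed.

Lemma ambient_isotopic_trans G G' G'' :
  ambient_isotopic G G' -> ambient_isotopic G' G'' -> ambient_isotopic G G''.
Proof.
move=> /ambient_isotopicP[h [s [ih [hv he]]]] /ambient_isotopicP[k [t [ik [kv ke]]]].
apply/ambient_isotopicP; exists (k \o h), (s * t)%g; split.
  exact: isotopic_id_comp.
split=> [i|a b ab]; first by rewrite /= hv kv permM.
by rewrite -image_comp he// ke ?permM// (inj_eq perm_inj).
Qed.

Lemma ambient_isotopic_sym G G' : ambient_isotopic G G' -> ambient_isotopic G' G.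
Proof.
move=> /ambient_isotopicP[h [s [ih [hv he]]]].
have [g hg gh] : bijective h.
  by case: ih => H iH <-; apply: ambient_isotopy_bij; rewrite ?ler01 ?lexx.
apply/ambient_isotopicP; exists g, (s^-1)%g; split.
  exact: isotopic_id_inv hg.
split=> [i|a b ab]; first by rewrite -{1}[i](permKV s) -hv hg.
rewrite -{1}[a](permKV s) -{1}[b](permKV s) -he; last by rewrite (inj_eq perm_inj).
rewrite image_comp (_ : g \o h = id) ?image_id//.
by apply/funext => x /=; rewrite hg.
Qed.

End isotopies.

(** * Isotopies of space fixing the point at infinity, and vertical pushes *)

Section space_isotopies.
Variable R : realType.
Local Notation S3 := (one_point_compactification (R * R * R)).
Local Notation space := (R * R * R)%type.

Lemma inj_surj_bijective (T : choiceType) (f : T -> T) :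
  injective f -> (forall y, exists x, f x = y) -> bijective f.
Proof.
move=> fi fs; pose g y := sval (cid (fs y)).
have fg y : f (g y) = y by rewrite /g; case: cid.
by exists g => // x; apply: fi.
Qed.

(** The last hypothesis makes preimages of bounded sets bounded uniformly in [t], which gives
    continuity at infinity. *)
Lemma isotopic_id_omap (F : R -> space -> space) (C M : R) :
  0 <= C -> continuous (fun tq : R * space => F tq.1 tq.2) ->
  (forall t, 0 <= t <= 1 -> bijective (F t)) -> (forall q, F 0 q = q) ->
  (forall t q, 0 <= t <= 1 -> `|q| <= C * `|F t q| + M) ->
  isotopic_id (omap (F 1) : S3 -> S3).
Proof.
move=> C0 cF bF F0 FM; exists (fun t => omap (F t)) => //.
apply: bijective_ambient_isotopy.
- apply/subspace_continuousP => -[t [q|]] [/= t01 _].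
  + apply: cvg_within_filter => W /= nW.
    have [[P Q] [/= tP qQ] PQ] := cF (t, q) _ nW.
    exists (P, Some @` Q).
      by split => //=; exact: one_point_compactification_some_nbhs.
    by move=> [t' _] [/= Pt' [q' Qq' <-]] /=; apply: (PQ (t', q')).
  + move=> W [U [cU _] UW].
    have [r [rR rU]] := compact_bounded cU.
    have {rU}rU q : U q -> `|q| <= r + 1 by apply: rU; rewrite ltrDl.
    pose V : set S3 := (Some @` (~` (box (C * (r + 1) + M)))) `|` [set None].
    have nV : nbhs (None : S3) V.
      by exists (box (C * (r + 1) + M)) => //; split; [exact: box_compact|exact: box_closed].
    rewrite /nbhs /= /within /=; exists (setT, V); first by split => //; exact: filterT.
    move=> [t' [q|]] [_ /= Vq] /= [t'01 _]; apply: UW; last by right.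
    left; exists (F t' q) => //= Uq; move: Vq => [[q' + [q'q]]|//]; apply.
    move: t'01; rewrite in_itv /= => t'01.
    apply/in_box; rewrite q'q (le_trans (FM _ _ t'01))// lerD2r ler_wpM2l//.
    exact: rU.
- move=> t /bF[g fg gf]; exists (omap g); by case=> //= q; rewrite ?fg ?gf.
- by case=> //= q; rewrite F0.
Qed.

(** Vertical displacements that are bounded and keep the order on every vertical line. Both
    conditions pass to [t * d] for [t] in [[0, 1]], so the straight-line homotopy is an isotopy. *)
Definition pushable (d : space -> R) :=
  [/\ continuous d, exists M, forall q, `|d q| <= M &
      forall p z z', z < z' -> z + d (p, z) < z' + d (p, z')].

Lemma isotopic_id_push (d : space -> R) : pushable d ->
  isotopic_id (omap (fun q : space => (q.1, q.2 + d q)) : S3 -> S3).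
Proof.
move=> [cd [M dM] md].
have M0 : 0 <= M by rewrite (le_trans _ (dM 0)).
pose F t (q : space) := (q.1, q.2 + t * d q).
have -> : (fun q : space => (q.1, q.2 + d q)) = F 1.
  by apply/funext => q; rewrite /F mul1r.
have mF t p z z' : 0 <= t <= 1 -> z < z' -> z + t * d (p, z) < z' + t * d (p, z').
  move=> /andP[t0 t1] zz'; have dd := md p _ _ zz'; rewrite -subr_gt0 in dd.
  have h1 : 0 <= (1 - t) * (z' - z) by rewrite mulr_ge0 ?subr_ge0// ltW.
  move: t0; rewrite le_eqVlt => /predU1P[<-|t0]; first by rewrite !mul0r !addr0.
  by have := mulr_gt0 t0 dd; lra.
have tM t q : 0 <= t <= 1 -> `|t * d q| <= M.
  move=> /andP[t0 t1]; rewrite normrM (ger0_norm t0) -[M]mul1r.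
  exact: ler_pM.
have cq : continuous (fun x : R * space => d x.2).
  exact: (continuous_compose (continuous_snd (@continuous_id _)) cd).
apply: (@isotopic_id_omap F 1 M) => //.
- by rewrite /F; cont.
- move=> t t01; apply: inj_surj_bijective => [[p z] [p' z'] [-> /eqP]|[p w]].
    by have [/(mF t p' _ _ t01)|/(mF t p' _ _ t01)|-> //] := ltgtP z z'; rewrite eq_sym; case: ltgtP.
  (* The displacement is at most [M], so the value [w] is attained between [w - M] and [w + M]. *)
  have [|||c _ cw] := @IVT _ (fun z => z + t * d (p, z)) (w - M) (w + M) w.
  + by rewrite lerD2l (le_trans _ M0)// oppr_le0.
  + apply: continuous_subspaceT; cont.
    apply: (@continuous_compose _ _ _ (fun z => (p, z))) cd; cont.
  + have := tM t (p, w - M) t01; have := tM t (p, w + M) t01.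
    by rewrite !ler_norml ge_min le_max => /andP[? _] /andP[_ ?]; lra.
  by exists (p, c); rewrite /F /= cw.
- by move=> [p z]; rewrite /F mul0r addr0.
- move=> t [p z] t01; rewrite mul1r /F /=.
  rewrite !prod_normE /= ge_max.
  have := tM t (p, z) t01; rewrite ler_norml => /andP[h1 h2].
  apply/andP; split; first by rewrite -[leLHS]addr0 lerD// le_max lexx.
  rewrite -[z in leLHS](addrK (t * d (p, z))) (le_trans (ler_normB _ _))//.
  by rewrite lerD ?tM// le_max lexx orbT.
Qed.

Definition graph_over (F : 'I_6 -> 'I_6 -> R * R -> R) : spatial_K6 R :=
  {| vertex := fun i => Some (plane_vertex R i, 0);
     edge := fun a b => [set Some (p, F a b p) | p in @chord R a b] |}.

Lemma push_graph_over (d : space -> R) (F F' : 'I_6 -> 'I_6 -> R * R -> R) :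
  pushable d -> (forall i, d (plane_vertex R i, 0) = 0) ->
  (forall a b p, a != b -> chord a b p -> F a b p + d (p, F a b p) = F' a b p) ->
  ambient_isotopic (graph_over F) (graph_over F').
Proof.
move=> pd d0 dF; apply/ambient_isotopicP.
exists (omap (fun q : space => (q.1, q.2 + d q))), 1%g; split.
  exact: isotopic_id_push.
split=> [i|a b ab]; first by rewrite /= perm1 d0 addr0.
rewrite !perm1 /= image_comp; apply: eq_imagel => p Cp /=.
by rewrite dF.
Qed.

Lemma eq_graph_over (F F' : 'I_6 -> 'I_6 -> R * R -> R) :
  (forall a b p, a != b -> chord a b p -> F a b p = F' a b p) ->
  ambient_isotopic (graph_over F) (graph_over F').
Proof.
move=> FF'; apply: (@push_graph_over (fun=> 0)) => //.
  split; first exact: continuous_cst.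
    by exists 0 => q; rewrite normr0.
  by move=> p z z'; rewrite !addr0.
by move=> a b p ab Cp; rewrite addr0 FF'.
Qed.

End space_isotopies.

(** * Independence of the shape of the sheets *)

Section stacks.
Variable R : realType.
Local Notation S3 := (one_point_compactification (R * R * R)).
Local Notation space := (R * R * R)%type.
Local Notation plane := (R * R)%type.

Definition beta (p : plane) : R := Num.max 0 (1 - (p.1 ^+ 2 + p.2 ^+ 2)).

Lemma beta_continuous : continuous beta.
Proof. by rewrite /beta; cont. Qed.

Lemma beta_ge0 p : 0 <= beta p.
Proof. by rewrite /beta le_max lexx. Qed.

Lemma beta_gt0 p : open_disk p -> 0 < beta p.
Proof. by rewrite /open_disk /beta /= lt_max subr_gt0 => ->; rewrite orbT. Qed.

Lemma beta_eq0 p : ~ open_disk p -> beta p = 0.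
Proof.
rewrite /open_disk /beta /= => /negP; rewrite -leNgt => h.
by apply/max_idPl; rewrite subr_le0.
Qed.

Lemma beta_disk p : closed_disk p -> beta p = 1 - (p.1 ^+ 2 + p.2 ^+ 2).
Proof. by rewrite /closed_disk /beta /= => h; apply/max_idPr; rewrite subr_ge0. Qed.

Lemma plane_vertex_circle i : circle (plane_vertex R i).
Proof. by rewrite /circle /plane_vertex /= sqrrN cos2Dsin2. Qed.

Lemma beta_vertex i : beta (plane_vertex R i) = 0.
Proof.
by apply: beta_eq0; rewrite /open_disk /= plane_vertex_circle ltxx.
Qed.

Lemma chord_disk a b p : chord a b p -> @closed_disk R p.
Proof.
move=> [t /=]; rewrite in_itv /= => /andP[t0 t1] <-.
have := plane_vertex_circle a; have := plane_vertex_circle b.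
case: (plane_vertex R a) (plane_vertex R b) => x y [x' y'].
rewrite /circle /closed_disk /= /GRing.scale /= => h1 h2.
have h3 : 0 <= t * (1 - t) * ((x - x') ^+ 2 + (y - y') ^+ 2).
  by rewrite mulr_ge0 ?addr_ge0 ?sqr_ge0// mulr_ge0// subr_ge0.
have -> : ((1 - t) * x + t * x') ^+ 2 + ((1 - t) * y + t * y') ^+ 2 =
  (1 - t) * (x ^+ 2 + y ^+ 2) + t * (x' ^+ 2 + y' ^+ 2) -
  t * (1 - t) * ((x - x') ^+ 2 + (y - y') ^+ 2) by ring.
by rewrite h1 h2; lra.
Qed.

Lemma bounded_off_disk (A : plane -> R) :
  continuous A -> (forall p, ~ open_disk p -> A p = 0) ->
  exists M, forall p, `|A p| <= M.
Proof.
move=> cA A0.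
have cK : compact (`[-1, 1]%classic `*` `[-1, 1]%classic : set plane).
  by apply: compact_setX; exact: segment_compact.
have := continuous_compact (continuous_subspaceT cA) cK.
move=> /compact_bounded[M [MR /(_ (M + 1))]]; rewrite ltrDl => /(_ ltr01) AM.
exists (Num.max 0 (M + 1)) => p; rewrite le_max.
have [Dp|/A0 ->] := pselect (open_disk p); last by rewrite normr0 lexx.
rewrite AM ?orbT//; exists p => //=; rewrite !in_itv /=.
move: Dp; rewrite /open_disk /= => Dp.
have := sqr_ge0 p.1; have := sqr_ge0 p.2 => h1 h2.
rewrite -!ler_norml -!(@ler_sqr _ _ 1) ?nnegrE// !real_normK ?num_real//.
by split; lra.
Qed.

(** Needed because the ramps below divide by the distance of two sheets, which vanishes on C; there
    the amplitude vanishes too. *)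
Lemma continuous_mul_bounded (T : topologicalType) (A g : T -> R) :
  continuous A -> (forall x, `|g x| <= 1) ->
  (forall x, A x != 0 -> {for x, continuous g}) ->
  continuous (fun x => A x * g x).
Proof.
move=> cA g1 cg x; have [A0|A0] := eqVneq (A x) 0; last first.
  by apply: cvgM; [exact: cA|exact: cg].
rewrite /continuous_at A0 mul0r; apply/cvgr0Pnorm_lt => e e0.
have := cA x; rewrite /continuous_at A0 => /cvgr0Pnorm_lt /(_ _ e0).
apply: filterS => y; apply: le_lt_trans.
by rewrite normrM -[leRHS]mulr1 ler_wpM2l.
Qed.

Definition clamp (x : R) : R := Num.max 0 (Num.min 1 x).

Lemma clamp_norm x : `|clamp x| <= 1.
Proof.
rewrite ger0_norm /clamp; last by rewrite le_max lexx.
by rewrite ge_max ler01 /= ge_min lexx.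
Qed.

Lemma clamp_lip x y : x <= y -> 0 <= clamp y - clamp x <= y - x.
Proof.
move=> xy; rewrite /clamp; case: (leP 1 x) => ?; case: (leP 1 y) => ?;
  case: (leP 0 x) => ?; case: (leP 0 y) => ?; rewrite ?(max_idPr ler01); do ?case: leP => ?; lra.
Qed.

Lemma clamp0 x : x <= 0 -> clamp x = 0.
Proof. by rewrite /clamp; case: (leP 1 x) => ?; case: leP => ?; lra. Qed.

Lemma clamp1 x : 1 <= x -> clamp x = 1.
Proof. by rewrite /clamp; case: (leP 1 x) => ?; case: leP => ?; lra. Qed.

Lemma pushable_translation (A : plane -> R) : continuous A ->
  (exists M, forall p, `|A p| <= M) -> pushable (fun q : space => A q.1).
Proof.
move=> cA [M AM]; split.
- exact: (continuous_compose (continuous_fst (@continuous_id _)) cA).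
- by exists M.
- by move=> p z z'; rewrite ltrD2r.
Qed.

(** The displacement is 0 below [lo], [A] above [hi], and affine in between. It preserves the order
    on fibres because the interval from [lo] to [hi] is mapped onto the one from [lo] to [hi + A],
    which is still nonempty. *)
Lemma pushable_ramp (A lo hi : plane -> R) :
  continuous A -> continuous lo -> continuous hi ->
  (forall p, ~ open_disk p -> A p = 0) ->
  (forall p, open_disk p -> lo p < hi p) ->
  (forall p, open_disk p -> lo p < hi p + A p) ->
  pushable (fun q : space => A q.1 * clamp ((q.2 - lo q.1) / (hi q.1 - lo q.1))).
Proof.
move=> cA clo chi A0 lohi lohiA.
have c1 (f : plane -> R) : continuous f -> continuous (fun q : space => f q.1).
  by move=> cf; exact: (continuous_compose (continuous_fst (@continuous_id _)) cf).
split.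
- apply: continuous_mul_bounded; [exact: c1|by move=> x; exact: clamp_norm|].
  move=> q Aq.
  have Dq : open_disk q.1 by apply: contrapT => /A0 /eqP; exact/negP.
  apply: (@continuous_max _ _ (fun=> 0)); first exact: cvg_cst.
  apply: (@continuous_min _ _ (fun=> 1)); first exact: cvg_cst.
  apply: cvgM; first by apply: cvgB; [exact: cvg_snd|exact: c1].
  apply: cvgV; first by rewrite subr_eq0 gt_eqF// lohi.
  by apply: cvgB; exact: c1.
- have [M AM] := bounded_off_disk cA A0; exists M => q.
  rewrite normrM -[M]mulr1; apply: ler_pM => //; exact: clamp_norm.
- move=> p z z' zz' /=.
  have [Dp|/A0 ->] := pselect (open_disk p); last by rewrite !mul0r !addr0.
  have w0 : 0 < hi p - lo p by rewrite subr_gt0 lohi.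
  have := lohiA _ Dp; set w := hi p - lo p in w0 * => wA.
  have {}wA : - w < A p by rewrite /w; lra.
  have /clamp_lip : (z - lo p) / w <= (z' - lo p) / w.
    by rewrite ler_pM2r ?invr_gt0// lerD2r ltW.
  rewrite -mulrBl opprB addrA subrK.
  set c' := clamp _; set c := clamp _ => /andP[c0 cz].
  have czw : (c' - c) * w <= z' - z by rewrite -ler_pdivlMr.
  have [A0'|A0'] := leP 0 (A p).
    by have := mulr_ge0 A0' c0; lra.
  have [cc|cc] := eqVneq c' c; first by rewrite cc ltrD2r.
  have {cc}c0 : 0 < c' - c by rewrite lt_def c0 subr_eq0 cc.
  have := mulr_gt0 c0 (_ : 0 < A p + w); rewrite -ltrBlDr sub0r => /(_ wA).
  by lra.
Qed.

Definition stack (s : nat) (H : nat -> plane -> R) :=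
  [/\ forall i, (i < s)%N -> continuous (H i),
      forall i p, (i < s)%N -> ~ open_disk p -> H i p = 0 &
      forall i j p, (i < j < s)%N -> open_disk p -> H j p < H i p].

Lemma stack_le s H i j p : stack s H -> (i <= j < s)%N -> H j p <= H i p.
Proof.
move=> [_ H0 Hlt] /andP[]; rewrite leq_eqVlt => /predU1P[->//|ij] js.
have [Dp|nDp] := pselect (open_disk p).
  by apply/ltW/Hlt => //; rewrite ij.
by rewrite !H0// (ltn_trans ij).
Qed.

(* The sheets are moved one after the other, from the bottom upwards; the sheets
   above the current one are carried along. *)
Lemma stack_graph_over s (H V : nat -> plane -> R) (pg : 'I_6 -> 'I_6 -> nat) :
  stack s H -> stack s V -> (forall a b, pg a b < s)%N ->
  ambient_isotopic (graph_over (fun a b => H (pg a b)))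
                   (graph_over (fun a b => V (pg a b))).
Proof.
move=> sH sV pgs; have [cH H0 Hlt] := sH; have [cV V0 Vlt] := sV.
(* Stage [j]: the sheets from [j] downwards are in their final position, and those above keep their
   original distance to sheet [j]. *)
pose D j i p := if (j <= i)%N then V i p else H i p + V j p - H j p.
have circ i : ~ open_disk (plane_vertex R i).
  by rewrite /open_disk /= plane_vertex_circle ltxx.
have step j : (j < s)%N -> ambient_isotopic (graph_over (fun a b => D j (pg a b)))
                   (graph_over (fun a b => V (pg a b))).
  elim: j => [_|j IHj js].
    by apply: eq_graph_over => a b p _ _; rewrite /D leq0n.
  have js' := ltnW js.
  apply: ambient_isotopic_trans (IHj js').
  (* The ramp fixes all points up to [V j.+1] and translates those from the present position of
     sheet [j] upwards by the amount that takes this sheet to [V j]. *)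
  apply: (@push_graph_over _ (fun q : space =>
    (V j q.1 - H j q.1 - V j.+1 q.1 + H j.+1 q.1) *
    clamp ((q.2 - V j.+1 q.1) / (H j q.1 + V j.+1 q.1 - H j.+1 q.1 - V j.+1 q.1)))).
  - apply: (@pushable_ramp (fun p => V j p - H j p - V j.+1 p + H j.+1 p) (V j.+1)
      (fun p => H j p + V j.+1 p - H j.+1 p)).
    + by cont; auto.
    + by auto.
    + by cont; auto.
    + by move=> p Dp; rewrite !H0// !V0//; lra.
    + by move=> p Dp; have := Hlt j j.+1 p; rewrite ltnSn js => /(_ isT Dp); lra.
    + by move=> p Dp; have := Vlt j j.+1 p; rewrite ltnSn js => /(_ isT Dp); lra.
  - by move=> i /=; rewrite !H0 ?V0//; lra.
  - move=> a b p _ _; move: (pg a b) (pgs a b) => i ils; rewrite /D /=.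
    have [Dp|Dp] := pselect (open_disk p); last first.
      by rewrite !H0// !V0//; case: ifP => _; case: ifP => _; lra.
    have w0 : 0 < H j p + V j.+1 p - H j.+1 p - V j.+1 p.
      by have := Hlt j j.+1 p; rewrite ltnSn js => /(_ isT Dp); lra.
    have [ji|] := ltnP j i.
      rewrite (ltnW ji) clamp0 ?mulr0 ?addr0//.
      by rewrite pmulr_lle0 ?invr_gt0// subr_le0; apply: stack_le sV _; rewrite ji.
    rewrite leq_eqVlt => ij; rewrite clamp1 ?mulr1.
      by case/predU1P: ij => [->|ij]; [rewrite leqnn|rewrite [(j <= i)%N]leqNgt ij /=]; lra.
    rewrite ler_pdivlMr// mul1r; have : H j p <= H i p; last by lra.
    by apply: stack_le sH _; rewrite js' andbT leq_eqVlt.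
have s0 : (0 < s)%N by apply: leq_ltn_trans (pgs ord0 ord0).
apply: ambient_isotopic_trans (step s.-1 _); last by rewrite prednK.
have ss : (s.-1 < s)%N by rewrite prednK.
(* A translation brings the bottom sheet into place. *)
apply: (@push_graph_over _ (fun q : space => V s.-1 q.1 - H s.-1 q.1)).
- apply: (@pushable_translation (fun p => V s.-1 p - H s.-1 p)).
    by cont; auto.
  apply: bounded_off_disk; first by cont; auto.
  by move=> p Dp; rewrite V0// H0// subrr.
- by move=> i; rewrite /= V0 ?H0 ?subrr.
- move=> a b p _ _ /=; move: (pg a b) (pgs a b) => i ils; rewrite /D.
  case: leqP => [|_]; last by lra.
  move=> si; have -> : i = s.-1 by apply/eqP; rewrite eqn_leq si andbT -ltnS prednK.
  lra.
Qed.

Definition level_graph (x : 'I_6 -> 'I_6 -> R) :=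
  graph_over (fun a b p => x a b * beta p).

Lemma stack_beta s (x : nat -> R) :
  (forall i j, (i < j < s)%N -> x j < x i) -> stack s (fun i p => x i * beta p).
Proof.
move=> xlt; split.
- by move=> i _; cont; exact: beta_continuous.
- by move=> i p _ Dp; rewrite beta_eq0 ?mulr0.
- by move=> i j p ij Dp; rewrite ltr_pM2r ?beta_gt0// xlt.
Qed.

(** Radial retraction onto the closed disk. The heights of a book are continuous only within that
    disk; composing with [retract] extends them to the plane, by 0 outside. *)
Definition retract (p : plane) : plane :=
  (p.1 / Num.max 1 (Num.sqrt (p.1 ^+ 2 + p.2 ^+ 2)),
   p.2 / Num.max 1 (Num.sqrt (p.1 ^+ 2 + p.2 ^+ 2))).

Lemma retract_continuous : continuous retract.
Proof.
by rewrite /retract; cont => p; rewrite gt_eqF// lt_max ltr01.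
Qed.

Lemma norm2_le1 (p : plane) :
  (Num.sqrt (p.1 ^+ 2 + p.2 ^+ 2) <= 1) = (p.1 ^+ 2 + p.2 ^+ 2 <= 1).
Proof. by rewrite -[X in _ <= X]sqrtr1 ler_sqrt. Qed.

Lemma retract_disk p : closed_disk p -> retract p = p.
Proof.
rewrite /closed_disk /= -norm2_le1 => h.
by rewrite /retract (max_idPl h) !divr1 -surjective_pairing.
Qed.

Lemma retract_circle p : ~ open_disk p -> circle (retract p).
Proof.
rewrite /open_disk /circle /retract /= => /negP; rewrite -leNgt => h.
have s0 : 0 < p.1 ^+ 2 + p.2 ^+ 2 by apply: lt_le_trans h.
have -> : Num.max 1 (Num.sqrt (p.1 ^+ 2 + p.2 ^+ 2)) = Num.sqrt (p.1 ^+ 2 + p.2 ^+ 2).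
  by apply/max_idPr; rewrite -[X in X <= _]sqrtr1 ler_sqrt//; exact: ltW.
by rewrite !expr_div_n -mulrDl sqr_sqrtr ?divff ?gt_eqF// ltW.
Qed.

Lemma retract_closed_disk p : closed_disk (retract p).
Proof.
have [Dp|/retract_circle] := pselect (open_disk p).
  have Dp' : closed_disk p by rewrite /closed_disk /= ltW.
  by rewrite retract_disk.
by rewrite /circle /closed_disk /= => ->.
Qed.

Definition sheet s (B : book R s) (n : nat) (p : plane) : R :=
  if insub n is Some k then height B k (retract p) else 0.

Lemma sheetE s (B : book R s) (k : 'I_s) p :
  sheet B k p = height B k (retract p).
Proof. by rewrite /sheet valK. Qed.

Lemma sheet_stack s (B : book R s) : stack s (sheet B).
Proof.
split.
- move=> i ils; apply/continuous_subspace_setT.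
  have -> : sheet B i = height B (Ordinal ils) \o retract.
    by apply/funext => p; exact: (sheetE B (Ordinal ils)).
  have := @subspace_continuous_comp plane plane R setT (@closed_disk R) retract
    (height B (Ordinal ils)); apply.
  - by move=> p _; exact: retract_closed_disk.
  - by apply: continuous_subspaceT; exact: retract_continuous.
  - exact: height_continuous.
- move=> i p ils /retract_circle Cp.
  by have -> := sheetE B (Ordinal ils) p; rewrite height_circle.
- move=> i j p /andP[ij js] Dp.
  have -> := sheetE B (Ordinal js) p; have -> := sheetE B (Ordinal (ltn_trans ij js)) p.
  rewrite retract_disk; first exact: height_stacked.
  by rewrite /closed_disk /= ltW.
Qed.

(** Both the given sheets and the multiples of [beta] form stacks, so only the assignment of edges
    to pages survives. *)
Lemma book_level_graph s (B : book R s) (x : nat -> R) :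
  (forall i j, (i < j < s)%N -> x j < x i) ->
  ambient_isotopic (book_graph B) (level_graph (fun a b => x (page B a b))).
Proof.
move=> xlt.
apply: (@ambient_isotopic_trans _ _ (graph_over (fun a b => sheet B (page B a b)))).
  apply: (@eq_graph_over _ (fun a b => height B (page B a b))) => a b p _ /chord_disk Dp.
  by rewrite sheetE retract_disk.
apply: (@stack_graph_over s _ (fun i p => x i * beta p)) => //.
  exact: sheet_stack.
exact: stack_beta.
Qed.

End stacks.

(** * Geometry of the hexagon and its chords *)

Definition nat_cross (a b c d : nat) : bool :=
  uniq [:: a; b; c; d] &&
  ((minn a b < c < maxn a b)%N (+) (minn a b < d < maxn a b)%N).

Lemma edges_crossE (a b c d : 'I_6) : edges_cross a b c d = nat_cross a b c d.
Proof. by rewrite /edges_cross -(map_inj_uniq val_inj). Qed.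

Definition ord6_all (P : nat -> bool) := all P (iota 0 6).

Lemma ord6_allP (P : nat -> bool) (i : 'I_6) : ord6_all P -> P i.
Proof. by move/allP; apply; rewrite mem_iota /=. Qed.

Section vertices.
Variable R : realType.
Local Notation plane := (R * R)%type.

Definition half_sqrt3 : R := Num.sqrt 3 / 2.
Local Notation k := half_sqrt3.

Lemma half_sqrt3_gt0 : 0 < k.
Proof. by rewrite /k divr_gt0// sqrtr_gt0. Qed.

Lemma half_sqrt3_sqr : k ^+ 2 = 3 / 4.
Proof. by rewrite /k expr_div_n sqr_sqrtr//; lra. Qed.

Lemma cos_pi3 : cos (pi / 3 : R) = 1 / 2.
Proof.
have c0 : 0 < cos (pi / 3 : R).
  by apply: cos_gt0_pihalf; have := pi_gt0 R; lra.
have h : cos (pi / 3 + (pi / 3 + pi / 3) : R) = -1.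
  by rewrite (_ : _ + _ = pi) ?cospi//; lra.
move: h; rewrite cosD cosD sinD.
have := cos2Dsin2 (pi / 3 : R); move: c0.
set c := cos _; set s := sin _ => c0 cs h.
(* The triple-angle formula turns [cos pi = -1] into this cubic equation. *)
have : (c + 1) * (2 * c - 1) ^+ 2 = 0.
  have -> : (c + 1) * (2 * c - 1) ^+ 2 = 4 * c ^+ 3 - 3 * c + 1 by ring.
  have s2 : s ^+ 2 = 1 - c ^+ 2 by rewrite -cs; ring.
  have : c * (c * c - s * s) - s * (s * c + c * s) = 4 * c ^+ 3 - 3 * c.
    have -> : c * (c * c - s * s) - s * (s * c + c * s) = c ^+ 3 - 3 * c * s ^+ 2 by ring.
    by rewrite s2; ring.
  by rewrite h; lra.
move/eqP; rewrite mulf_eq0 sqrf_eq0 => /orP[/eqP|/eqP]; lra.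
Qed.

Lemma sin_pi3 : sin (pi / 3 : R) = k.
Proof.
have s0 : 0 < sin (pi / 3 : R).
  by apply: sin_gt0_pi; have := pi_gt0 R; lra.
apply/eqP; rewrite -(@eqrXn2 _ 2)//; [|exact: ltW|exact/ltW/half_sqrt3_gt0].
have := cos2Dsin2 (pi / 3 : R); rewrite cos_pi3 half_sqrt3_sqr => h.
by apply/eqP; lra.
Qed.

(** Integer coordinates of the vertices in the units [1 / 2] and [k], so that questions about sides
    of lines are decided by computation. *)
Definition vx (i : nat) : int := nth 0 [:: 2; 1; -1; -2; -1; 1]%Z i.
Definition vy (i : nat) : int := nth 0 [:: 0; -1; -1; 0; 1; 1]%Z i.

Lemma plane_vertexE (i : 'I_6) :
  plane_vertex R i = ((vx i)%:~R / 2, (vy i)%:~R * k).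
Proof.
have h (n : nat) : 2 * pi * n%:R / 6 = n%:R * (pi / 3) :> R by lra.
rewrite /plane_vertex h; have kk := half_sqrt3_sqr.
have S n c s : cos (n%:R * (pi / 3)) = c :> R /\ sin (n%:R * (pi / 3)) = s ->
    cos (n.+1%:R * (pi / 3)) = c / 2 - s * k :> R /\
    sin (n.+1%:R * (pi / 3)) = s / 2 + c * k.
  move=> [hc hs]; rewrite -natr1 mulrDl mul1r cosD sinD hc hs cos_pi3 sin_pi3.
  by split; lra.
have s0 : cos (0%:R * (pi / 3)) = 1 :> R /\ sin (0%:R * (pi / 3)) = 0 :> R.
  by rewrite mul0r cos0 sin0.
pose A (n : nat) (c s : R) := cos (n%:R * (pi / 3)) = c /\ sin (n%:R * (pi / 3)) = s.
have step n c s c' s' : c' = c / 2 - s * k -> s' = s / 2 + c * k ->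
    A n c s -> A n.+1 c' s'.
  by move=> -> ->; exact: S.
have s1 : A 1%N (1 / 2) (k) by apply: step s0; lra.
have s2 : A 2%N (- 1 / 2) (k) by apply: step s1; nra.
have s3 : A 3%N (- 1) (0) by apply: step s2; nra.
have s4 : A 4%N (- 1 / 2) (- k) by apply: step s3; nra.
have s5 : A 5%N (1 / 2) (- k) by apply: step s4; nra.
case: i => -[|[|[|[|[|[|//]]]]]] /= _; rewrite /vx /vy /=.
- by case: s0 => -> ->; congr pair; lra.
- by case: s1 => -> ->; congr pair; lra.
- by case: s2 => -> ->; congr pair; lra.
- by case: s3 => -> ->; congr pair; lra.
- by case: s4 => -> ->; congr pair; lra.
- by case: s5 => -> ->; congr pair; lra.
Qed.

(** A linear form that vanishes on the line through the vertices [c] and [d]; its absolute value is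
    proportional to the distance from that line. *)
Definition side (c d : 'I_6) (p : plane) : R :=
  (p.1 - (plane_vertex R c).1) * ((plane_vertex R d).2 - (plane_vertex R c).2) -
  (p.2 - (plane_vertex R c).2) * ((plane_vertex R d).1 - (plane_vertex R c).1).

Definition nat_side (c d a : nat) : int :=
  (vx a - vx c) * (vy d - vy c) - (vy a - vy c) * (vx d - vx c).

Lemma side_vertex (c d a : 'I_6) :
  side c d (plane_vertex R a) = k / 2 * (nat_side c d a)%:~R.
Proof.
rewrite /side /nat_side !plane_vertexE /= !(intrB, intrM, intrD).
by lra.
Qed.

Lemma side_chord c d p : chord c d p -> side c d p = 0.
Proof. by move=> [t _ <-]; rewrite /side /= /GRing.scale /=; ring. Qed.

Lemma side_noncrossing (a b c d : 'I_6) : a != b -> c != d ->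
  (a, b) != (c, d) -> (a, b) != (d, c) -> ~~ edges_cross a b c d ->
  0 <= nat_side c d a * nat_side c d b /\
  (nat_side c d a != 0) || (nat_side c d b != 0).
Proof.
have H : ord6_all (fun a => ord6_all (fun b => ord6_all (fun c => ord6_all (fun d =>
  [==> a != b, c != d, (a, b) != (c, d), (a, b) != (d, c), ~~ nat_cross a b c d =>
   (0 <= nat_side c d a * nat_side c d b) &&
   ((nat_side c d a != 0) || (nat_side c d b != 0))])))) by vm_compute.
have := ord6_allP d (ord6_allP c (ord6_allP b (ord6_allP a H))).
rewrite edges_crossE -!val_eqE /= !xpair_eqE.
by move=> h ab cd e1 e2 nx; move: h; rewrite ab cd e1 e2 nx /= => /andP[].
Qed.

(** Along a chord [beta] is [t * (1 - t)] times the squared length, and C has diameter 2. *)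
Lemma beta_chord (a b : 'I_6) (t : R) : 0 <= t <= 1 ->
  beta ((1 - t) *: plane_vertex R a + t *: plane_vertex R b) <= 4 * (t * (1 - t)).
Proof.
move=> t01; rewrite beta_disk; last first.
  by apply: (@chord_disk _ a b); exists t.
have := plane_vertex_circle R a; have := plane_vertex_circle R b.
case: (plane_vertex R a) (plane_vertex R b) => x y [x' y'].
rewrite /circle /= /GRing.scale /= => h1 h2.
have := sqr_ge0 (x + x'); have := sqr_ge0 (y + y') => h3 h4.
have h5 : 0 <= t * (1 - t) by rewrite mulr_ge0//; lra.
have -> : ((1 - t) * x + t * x') ^+ 2 + ((1 - t) * y + t * y') ^+ 2 =
  (1 - t) * (x ^+ 2 + y ^+ 2) + t * (x' ^+ 2 + y' ^+ 2) -
  t * (1 - t) * (2 * (x ^+ 2 + y ^+ 2) + 2 * (x' ^+ 2 + y' ^+ 2)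
    - (x + x') ^+ 2 - (y + y') ^+ 2) by ring.
by rewrite h1 h2; have := mulr_ge0 h5 h3; have := mulr_ge0 h5 h4; lra.
Qed.

(** The endpoints of [ab] lie weakly on one side of [cd], and at one of them the integer [nat_side]
    is nonzero. Hence [|side|] is at least [k / 2] times [t] or [1 - t], while [beta] is at most
    [4 * t * (1 - t)]. *)
Lemma beta_side (a b c d : 'I_6) p : a != b -> c != d ->
  (a, b) != (c, d) -> (a, b) != (d, c) -> ~~ edges_cross a b c d ->
  chord a b p -> beta p <= 8 / k * `|side c d p|.
Proof.
move=> ab cd e1 e2 nx [t /=]; rewrite in_itv /= => t01 <-.
apply: le_trans (beta_chord a b t01) _.
have [s0 s1] := side_noncrossing ab cd e1 e2 nx.
have -> : side c d ((1 - t) *: plane_vertex R a + t *: plane_vertex R b) =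
    (1 - t) * side c d (plane_vertex R a) + t * side c d (plane_vertex R b).
  by rewrite /side /= /GRing.scale /=; ring.
rewrite !side_vertex; move: s0 s1; set m := nat_side _ _ _; set n := nat_side _ _ _.
have k0 := half_sqrt3_gt0.
move=> mn mn0.
have -> : (1 - t) * (k / 2 * m%:~R) + t * (k / 2 * n%:~R) =
   k / 2 * ((1 - t) * m%:~R + t * n%:~R) by ring.
rewrite normrM (ger0_norm (_ : 0 <= k / 2)) ?[leRHS]mulrA; last by rewrite divr_ge0// ltW.
have -> : 8 / k * (k / 2) = 4 :> R by field; rewrite gt_eqF.
rewrite ler_pM2l//.
have -> : `|(1 - t) * m%:~R + t * n%:~R| = (1 - t) * `|m|%:~R + t * `|n|%:~R :> R.
  have {mn0} : (0 <= m) && (0 <= n) || (m <= 0) && (n <= 0).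
    have [m0|m0|->] := ltgtP 0 m; last by rewrite /= ; case: ltgtP.
      by rewrite -(pmulr_rge0 _ m0) mn.
    by rewrite orbC -(nmulr_rge0 _ m0) mn.
  case/orP=> /andP[m0 n0].
    rewrite !ger0_norm// addr_ge0// mulr_ge0//; try lra; by rewrite ler0z.
  rewrite !ler0_norm ?intrN; try lra; rewrite -oppr_ge0 opprD -!mulrN -!intrN.
  by rewrite addr_ge0// mulr_ge0//; try lra; rewrite ler0z oppr_ge0.
have m0 : 0 <= `|m|%:~R :> R by rewrite ler0z.
have n0 : 0 <= `|n|%:~R :> R by rewrite ler0z.
case/orP: mn0 => nz.
  have : 1 <= `|m|%:~R :> R by rewrite ler1z -gtz0_ge1 normr_gt0.
  by nra.
have : 1 <= `|n|%:~R :> R by rewrite ler1z -gtz0_ge1 normr_gt0.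
by nra.
Qed.

End vertices.

(** * Moving single edges: only the order at crossings matters *)

Section moves.
Variable R : realType.
Local Notation space := (R * R * R)%type.
Local Notation plane := (R * R)%type.
Local Notation k := (half_sqrt3 R).

Definition coef_graph (F : 'I_6 -> 'I_6 -> plane -> R) :=
  graph_over (fun a b p => F a b p * beta p).

Lemma tent_lip (f g u v C : R) : 0 < u -> 0 < v ->
  - v <= Num.max 0 (Num.min (f + u) (g - v) - C) - Num.max 0 (Num.min f g - C) <= u.
Proof.
move=> u0 v0; case: (leP (f + u) (g - v)) => ?; case: (leP f g) => ?;
  do 2 (case: (leP 0 (_ - C)) => ?); lra.
Qed.

(* The displacement is a tent over the edge [cd]: in every fibre it is supported
   between the levels [L] and [U], and the term [side] kills it on the chords
   that do not cross [cd]. *)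
Lemma pushable_tent (c d : 'I_6) (r r' : plane -> R) (L U : R) :
  continuous r -> continuous r' ->
  (forall p, L < r p < U) -> (forall p, L < r' p < U) ->
  pushable (fun q : space => (r' q.1 - r q.1) *
    Num.max 0 (Num.min ((q.2 - L * beta q.1) / (r q.1 - L))
                       ((U * beta q.1 - q.2) / (U - r q.1))
               - 8 / k * `|side c d q.1|)).
Proof.
move=> cr cr' rLU r'LU.
have c1 (f : plane -> R) : continuous f -> continuous (fun q : space => f q.1).
  by move=> cf; exact: (continuous_compose (continuous_fst (@continuous_id _)) cf).
have cb := c1 _ (@beta_continuous R).
have k0 : 0 <= 8 / k by rewrite divr_ge0// ltW// half_sqrt3_gt0.
split.
- have := c1 _ cr; have := c1 _ cr'; move=> ? ?.
  rewrite /side; cont => //.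
    by move=> q; have := rLU q.1; lra.
  by move=> q; have := rLU q.1; lra.
- exists (U - L) => -[p z] /=; rewrite normrM -[leRHS]mulr1.
  have rp := rLU p; have r'p := r'LU p.
  apply: ler_pM => //; first by rewrite ler_norml; lra.
  rewrite ger0_norm ?le_max ?lexx// ge_max ler01 /=.
  have b1 : beta p <= 1.
    rewrite /beta ge_max ler01 /=; have := sqr_ge0 p.1; have := sqr_ge0 p.2; lra.
  have : Num.min ((z - L * beta p) / (r p - L)) ((U * beta p - z) / (U - r p)) <= beta p.
    rewrite ge_min !ler_pdivrMr ?subr_gt0; [|lra..].
    by have [zr|zr] := leP z (r p * beta p); apply/orP; [left|right]; lra.
  by have := mulr_ge0 k0 (normr_ge0 (side c d p)); lra.
- move=> p z z' zz' /=; have rp := rLU p; have r'p := r'LU p.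
  set C := 8 / k * _; set b := beta p.
  have [rL0 Ur0] : 0 < r p - L /\ 0 < U - r p by lra.
  have d1 : (z' - L * b) / (r p - L) = (z - L * b) / (r p - L) + (z' - z) / (r p - L).
    by rewrite -mulrDl; congr (_ / _); lra.
  have d2 : (U * b - z') / (U - r p) = (U * b - z) / (U - r p) - (z' - z) / (U - r p).
    by rewrite -mulrBl; congr (_ / _); lra.
  have p1 : 0 < (z' - z) / (r p - L) by rewrite divr_gt0 // subr_gt0.
  have p2 : 0 < (z' - z) / (U - r p) by rewrite divr_gt0 // subr_gt0.
  rewrite d1 d2; have := tent_lip ((z - L * b) / (r p - L)) ((U * b - z) / (U - r p)) C p1 p2.
  set T' := Num.max 0 _; set T := Num.max 0 _ => /andP[T1 T2].
  have q1 : (z' - z) / (r p - L) * (r p - L) = z' - z by rewrite divfK// gt_eqF.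
  have q2 : (z' - z) / (U - r p) * (U - r p) = z' - z by rewrite divfK// gt_eqF.
  set u := (z' - z) / (r p - L) in p1 q1 T2; set v := (z' - z) / (U - r p) in p2 q2 T1.
  have [A0|A0] := leP 0 (r' p - r p).
    have h1 : (r' p - r p) * v < (U - r p) * v by rewrite ltr_pM2r//; lra.
    have h2 : (r' p - r p) * (- v) <= (r' p - r p) * (T' - T) by rewrite ler_wpM2l.
    by lra.
  have h1 : (r p - r' p) * u < (r p - L) * u by rewrite ltr_pM2r//; lra.
  have h2 : (r p - r' p) * (T' - T) <= (r p - r' p) * u by rewrite ler_wpM2l//; lra.
  by lra.
Qed.

Lemma edges_cross_neq (a b c d : 'I_6) : edges_cross a b c d ->
  (a, b) != (c, d) /\ (a, b) != (d, c).
Proof.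
rewrite edges_crossE /nat_cross /= !inE !negb_or -!andbA => /and3P[_ ac].
by rewrite !xpair_eqE -!val_eqE (negbTE ac) => /andP[ad _]; rewrite (negbTE ad).
Qed.

(** The levels strictly between [L] and [U] form a window that contains the old and the new level of
    [cd] and that the edges crossing [cd] avoid. Those edges lie outside the support of the tent,
    and [beta_side] protects all the others. *)
Lemma move_edge (c d : 'I_6) (F F' : 'I_6 -> 'I_6 -> plane -> R)
    (r r' : plane -> R) (L U : R) :
  c != d -> continuous r -> continuous r' ->
  (forall p, L < r p < U) -> (forall p, L < r' p < U) ->
  (forall a b, (a, b) = (c, d) \/ (a, b) = (d, c) ->
     F a b = r /\ F' a b = r') ->
  (forall a b, (a, b) != (c, d) -> (a, b) != (d, c) -> F' a b = F a b) ->
  (forall a b p, edges_cross a b c d -> chord a b p -> F a b p <= L \/ U <= F a b p) ->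
  ambient_isotopic (coef_graph F) (coef_graph F').
Proof.
move=> cd cr cr' rLU r'LU Fr FF' Fx.
apply: push_graph_over (pushable_tent c d cr cr' rLU r'LU) _ _ => [i|a b p ab Cp] /=.
  rewrite beta_vertex !mulr0 subrr !mul0r minxx sub0r (max_idPl _) ?mulr0//.
  by rewrite oppr_le0 mulr_ge0// divr_ge0// ltW// half_sqrt3_gt0.
have rp := rLU p.
have [rL0 Ur0] : 0 < r p - L /\ 0 < U - r p by lra.
have b0 := beta_ge0 p.
have [e|e1] := eqVneq (a, b) (c, d).
  have [-> ->] := Fr a b (or_introl e).
  move: e => [? ?]; subst a b.
  rewrite (side_chord Cp) normr0 mulr0 subr0 -!mulrBl.
  rewrite !(mulrAC _ (beta p)) !divff ?gt_eqF// mul1r minxx (max_idPr b0).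
  by lra.
have [e|e2] := eqVneq (a, b) (d, c).
  have [-> ->] := Fr a b (or_intror e).
  move: e => [? ?]; subst a b.
  have Cp' : side c d p = 0.
    by have := side_chord Cp; rewrite /side; lra.
  rewrite Cp' normr0 mulr0 subr0 -!mulrBl.
  rewrite !(mulrAC _ (beta p)) !divff ?gt_eqF// mul1r minxx (max_idPr b0).
  by lra.
rewrite FF'// (max_idPl _) ?mulr0 ?addr0//.
have s0 : 0 <= 8 / k * `|side c d p|.
  by rewrite mulr_ge0// divr_ge0// ltW// half_sqrt3_gt0.
rewrite subr_le0; have [x|nx] := boolP (edges_cross a b c d).
  apply: le_trans s0; rewrite ge_min !pmulr_lle0 ?invr_gt0//.
  have [FL|FU] := Fx _ _ _ x Cp.
    by rewrite -mulrBl mulr_le0_ge0// subr_le0.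
  by apply/orP; right; rewrite -mulrBl mulr_le0_ge0// subr_le0.
apply: le_trans (beta_side ab cd e1 e2 nx Cp).
rewrite ge_min !ler_pdivrMr//; move: (F a b p * beta p) => z.
by have [zr|zr] := leP z (r p * beta p); apply/orP; [left|right]; lra.
Qed.

Lemma eq_coef_graph F F' : (forall a b p, a != b -> F a b p = F' a b p) ->
  ambient_isotopic (coef_graph F) (coef_graph F').
Proof. by move=> FF'; apply: eq_graph_over => a b p ab _; rewrite FF'. Qed.

Definition same_order (x y : 'I_6 -> 'I_6 -> nat) := forall a b c d,
  edges_cross a b c d ->
  (x a b < x c d)%N && (y a b < y c d)%N || (x c d < x a b)%N && (y c d < y a b)%N.

(* The edges are lifted above all others one by one, in the order of decreasing
   target level. *)
Lemma same_order_isotopic (x y : 'I_6 -> 'I_6 -> nat) :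
  (forall a b, x a b = x b a) -> (forall a b, y a b = y b a) -> same_order x y ->
  ambient_isotopic (level_graph (fun a b => (x a b)%:R : R))
                   (level_graph (fun a b => (y a b)%:R)).
Proof.
move=> xs ys xy.
pose N := (\max_(e : 'I_6 * 'I_6) x e.1 e.2).+1.
have xN a b : (x a b < N)%N by rewrite ltnS; exact: (@leq_bigmax _ _ (a, b)).
(* [S] is the set of edges already lifted; the offset [N] exceeds every old level. *)
pose z (S : {set 'I_6 * 'I_6}) a b := (if (a, b) \in S then y a b + N else x a b)%N.
have lift n (S : {set 'I_6 * 'I_6}) : (#|~: S| <= n)%N ->
    (forall a b, ((a, b) \in S) = ((b, a) \in S)) ->
    (forall e f, e \in S -> f \notin S -> y f.1 f.2 <= y e.1 e.2)%N ->
    ambient_isotopic (level_graph (fun a b => (z S a b)%:R : R))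
                     (level_graph (fun a b => (y a b + N)%:R)).
  elim: n S => [|n IHn] S Sn Ss Sy.
    apply: (@eq_coef_graph (fun a b _ => _) (fun a b _ => _)) => a b _ _.
    rewrite /z; have -> // : (a, b) \in S.
    by apply: contraLR Sn => nS; rewrite -ltnNge; apply/card_gt0P; exists (a, b); rewrite inE.
  have [S0|[e0 e0S]] := set_0Vmem (~: S).
    by apply: IHn => //; rewrite S0 cards0.
  pose e := [arg max_(e > e0 in ~: S) y e.1 e.2].
  have [eS emax] : e \in ~: S /\ forall f, f \in ~: S -> (y f.1 f.2 <= y e.1 e.2)%N.
    by rewrite /e; case: arg_maxnP.
  move: e eS emax => [c d]; rewrite inE /= => eS emax {e0 e0S}.
  pose S' := (c, d) |: ((d, c) |: S).
  have S'E a b : ((a, b) \in S') = [|| (a, b) == (c, d), (a, b) == (d, c) | (a, b) \in S].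
    by rewrite !inE.
  apply: (@ambient_isotopic_trans _ _ (level_graph (fun a b => (z S' a b)%:R : R))); last first.
    apply: IHn.
    - rewrite -ltnS (leq_trans _ Sn)//; apply: proper_card.
      apply/properP; split.
        by apply/fintype.subsetP => u; rewrite !inE !negb_or => /and3P[].
      by exists (c, d); rewrite inE // S'E eqxx.
    - move=> a b; rewrite !S'E Ss !xpair_eqE.
      by rewrite (andbC (b == c)) (andbC (b == d)) orbCA.
    - move=> [a b] [a' b']; rewrite !S'E !negb_or => h /and3P[_ _ nS].
      have /= m := emax (a', b'); rewrite inE nS in m.
      case/or3P: h => [/eqP[-> ->]|/eqP[-> ->]|h]; [exact: m|by rewrite [y d c]ys m|].
      exact: (Sy (a, b) (a', b')).
  have zS' a b : (a, b) = (c, d) \/ (a, b) = (d, c) -> z S' a b = (y c d + N)%N.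
    by rewrite /z S'E => -[] [-> ->]; rewrite eqxx ?orbT // [y d c]ys.
  have zS a b : (a, b) = (c, d) \/ (a, b) = (d, c) -> z S a b = x c d.
    by rewrite /z => -[] [-> ->]; [|rewrite Ss [x d c]xs]; rewrite (negbTE eS).
  have zSS' a b : (a, b) != (c, d) -> (a, b) != (d, c) -> z S' a b = z S a b.
    by move=> e1 e2; rewrite /z S'E (negbTE e1) (negbTE e2).
  have [cd|cd] := eqVneq c d.
    apply: (@eq_coef_graph (fun a b _ => _) (fun a b _ => _)) => a b _ ab.
    have [[ac bd]|n1] := eqVneq (a, b) (c, d); first by move: ab; rewrite ac bd cd eqxx.
    by rewrite zSS'//; move: n1; rewrite cd.
  (* The window reaches from one below the old level to one above the new one. A crossing edge in
     [S] has a larger target level and lies above it; one outside [S] has a smaller target level,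
     hence by [same_order] a smaller old level, and lies below it. *)
  apply: (@move_edge c d (fun a b _ => (z S a b)%:R) (fun a b _ => (z S' a b)%:R)
    (fun=> (x c d)%:R) (fun=> (y c d + N)%:R) ((x c d)%:R - 1) ((y c d + N)%:R + 1)) => //.
  - exact: continuous_cst.
  - exact: continuous_cst.
  - move=> p; have : (x c d)%:R <= (y c d + N)%:R :> R.
      by rewrite ler_nat (leq_trans (ltnW (xN c d)))// leq_addl.
    by lra.
  - move=> p; have : (x c d)%:R <= (y c d + N)%:R :> R.
      by rewrite ler_nat (leq_trans (ltnW (xN c d)))// leq_addl.
    by lra.
  - by move=> a b ab; rewrite zS// zS'.
  - by move=> a b e1 e2; rewrite zSS'.
  - move=> a b p X _; have := xy _ _ _ _ X; rewrite /z.
    case: ifPn => abS h.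
      right; rewrite natr1 ler_nat -addSn leq_add2r.
      have := Sy (a, b) (c, d) abS eS; rewrite /= leqNgt.
      by case/orP: h => /andP[_ h] //; rewrite h.
    left; rewrite lerBrDr natr1 ler_nat.
    have := emax (a, b); rewrite inE => /(_ abS) /=; rewrite leqNgt.
    by case/orP: h => /andP[h1 h2]; rewrite ?h2.
apply: (@ambient_isotopic_trans _ _ (level_graph (fun a b => (y a b + N)%:R))).
  apply: (@ambient_isotopic_trans _ _
    (level_graph (fun a b => (z finset.set0 a b)%:R : R))).
    by apply: (@eq_coef_graph (fun a b _ => _) (fun a b _ => _)) => a b _ _; rewrite /z inE.
  by apply: (lift _ _ (leqnn _)) => [a b|e f]; rewrite !inE.
(* Undo the common offset [N]. *)
apply: (@push_graph_over _ (fun q : space => - (N%:R * beta q.1))).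
- apply: (@pushable_translation _ (fun p => - (N%:R * beta p))).
    by cont; exact: beta_continuous.
  apply: bounded_off_disk; first by cont; exact: beta_continuous.
  by move=> p /beta_eq0 ->; rewrite mulr0 oppr0.
- by move=> i; rewrite /= beta_vertex mulr0 oppr0.
- by move=> a b p _ _ /=; rewrite natrD; lra.
Qed.

End moves.

(** * Rotation of the hexagon *)

Section rotation.
Variable R : realType.
Local Notation S3 := (one_point_compactification (R * R * R)).
Local Notation space := (R * R * R)%type.
Local Notation plane := (R * R)%type.

Definition turn (th : R) (p : plane) : plane :=
  (cos th * p.1 + sin th * p.2, - sin th * p.1 + cos th * p.2).

Lemma turnK th p : turn (- th) (turn th p) = p.
Proof.
case: p => x y; rewrite /turn /= cosN sinN; have := cos2Dsin2 th.
set c := cos th; set s := sin th => h; congr pair.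
  by transitivity ((c ^+ 2 + s ^+ 2) * x); [ring|rewrite h mul1r].
by transitivity ((c ^+ 2 + s ^+ 2) * y); [ring|rewrite h mul1r].
Qed.

Lemma turn0 p : turn 0 p = p.
Proof.
case: p => x y.
by rewrite /turn /= cos0 sin0 !mul1r oppr0 !mul0r addr0 add0r.
Qed.

Lemma turn_norm2 th p :
  (turn th p).1 ^+ 2 + (turn th p).2 ^+ 2 = p.1 ^+ 2 + p.2 ^+ 2.
Proof.
case: p => x y; rewrite /turn /=; have := cos2Dsin2 th.
set c := cos th; set s := sin th => h.
transitivity ((c ^+ 2 + s ^+ 2) * (x ^+ 2 + y ^+ 2)); first ring.
by rewrite h mul1r.
Qed.

Lemma turn_convex th (t : R) (p q : plane) :
  turn th ((1 - t) *: p + t *: q) = (1 - t) *: turn th p + t *: turn th q.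
Proof.
case: p q => x y [x' y']; rewrite [RHS]surjective_pairing.
by rewrite /turn /= /GRing.scale /=; congr pair; ring.
Qed.

Lemma turn_continuous (T : topologicalType) (f : T -> R) (g : T -> plane) :
  continuous f -> continuous g -> continuous (fun x => turn (f x) (g x)).
Proof.
move=> cf cg; have cc := continuous_compose cf (@continuous_cos R).
have cs := continuous_compose cf (@continuous_sin R).
by rewrite /turn; cont.
Qed.

Lemma isotopic_id_turn th :
  isotopic_id (omap (fun q : space => (turn th q.1, q.2)) : S3 -> S3).
Proof.
pose F t (q : space) := (turn (t * th) q.1, q.2).
have -> : (fun q : space => (turn th q.1, q.2)) = F 1.
  by apply/funext => q; rewrite /F mul1r.
(* The norm is the maximum norm, which a rotation at most doubles. *)
apply: (@isotopic_id_omap _ F 2 0) => //.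
- by rewrite /F; apply: continuous_pair; [apply: turn_continuous|]; cont.
- move=> t _; exists (F (- t)) => -[p z]; rewrite /F /= mulNr ?turnK//.
  by rewrite -{1}(opprK (t * th)) turnK.
- by move=> [p z]; rewrite /F mul0r turn0.
- move=> t [p z] _; rewrite addr0 /F -[p in leLHS](turnK (t * th)).
  case: (turn (t * th) _) => x y; rewrite /turn /= !prod_normE /= cosN sinN opprK.
  set c := cos _; set s := sin _.
  have c1 : `|c| <= 1 by rewrite ler_norml cos_geN1 cos_le1.
  have s1 : `|s| <= 1 by rewrite ler_norml sin_geN1 sin_le1.
  set m := Num.max (Num.max `|x| `|y|) `|z|.
  have xm : `|x| <= m by rewrite /m !le_max lexx.
  have ym : `|y| <= m by rewrite /m !le_max lexx orbT.
  have zm : `|z| <= m by rewrite /m !le_max lexx orbT.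
  have h (a b : R) : `|a| <= 1 -> `|b| <= 1 -> `|a * x + b * y| <= 2 * m.
    move=> a1 b1; rewrite (le_trans (ler_normD _ _))// !normrM.
    have := ler_pM (normr_ge0 a) (normr_ge0 x) a1 xm.
    have := ler_pM (normr_ge0 b) (normr_ge0 y) b1 ym.
    by lra.
  rewrite !ge_max !h ?normrN//=.
  by have := normr_ge0 z; lra.
Qed.

Definition ordS_perm : {perm 'I_6} := perm (@ordS_inj 6).

Lemma turn_vertex i : turn (pi / 3) (plane_vertex R i) = plane_vertex R (ordS i).
Proof.
rewrite !plane_vertexE /turn cos_pi3 sin_pi3 /=; have kk := half_sqrt3_sqr R.
case: i => -[|[|[|[|[|[|//]]]]]] /= _; rewrite /vx /vy /=; congr pair; nra.
Qed.

Lemma rotate_level_graph (x y : 'I_6 -> 'I_6 -> R) :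
  (forall a b, y (ordS a) (ordS b) = x a b) ->
  ambient_isotopic (level_graph x) (level_graph y).
Proof.
move=> xy; apply/ambient_isotopicP.
exists (omap (fun q : space => (turn (pi / 3) q.1, q.2))), ordS_perm; split.
  exact: isotopic_id_turn.
split=> [i|a b _]; first by rewrite /= permE turn_vertex.
rewrite !permE /= image_comp; apply/seteqP; split=> [_ [_ [t t01 <-] <-]|_ [_ [t t01 <-] <-]] /=.
  exists (turn (pi / 3) ((1 - t) *: plane_vertex R a + t *: plane_vertex R b)).
    by exists t => //; rewrite turn_convex !turn_vertex.
  by rewrite xy /beta turn_norm2.
exists ((1 - t) *: plane_vertex R a + t *: plane_vertex R b); first by exists t.
by rewrite -!turn_vertex -turn_convex /= xy /beta turn_norm2.
Qed.

End rotation.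

(** * Half a turn of the open book with binding C *)

Section open_book.
Variable R : realType.
Local Notation S3 := (one_point_compactification (R * R * R)).
Local Notation space := (R * R * R)%type.
Local Notation plane := (R * R)%type.

Definition norm2 (q : space) : R := q.1.1 ^+ 2 + q.1.2 ^+ 2 + q.2 ^+ 2.

Definition ball_part (q : space) : space :=
  ((q.1.1 / Num.max 1 (norm2 q), q.1.2 / Num.max 1 (norm2 q)),
   q.2 / Num.max 1 (norm2 q)).

Definition depth (q : space) : R := (1 - norm2 q) / Num.max 1 (norm2 q).

(* The page coordinates: [S3] is the set of pairs [(p, v)] of planar vectors with
   [|v| = 1 - |p|^2], where [p] is the projection to the disk and the direction of
   [v] is the page.  The unit ball carries the pages with angle at most [2 pi / 3]
   from [(1, 0)]; the outside of the ball is reached by inversion. *)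
Definition page_coord (x : S3) : plane * plane :=
  if x is Some q then
    ((ball_part q).1,
     (depth q - (ball_part q).2 ^+ 2 / 2,
      (ball_part q).2 * Num.sqrt (Num.max (3 * depth q) (- depth q) +
                                  3 / 4 * (ball_part q).2 ^+ 2)))
  else ((0, 0), (-1, 0)).

Definition page_space : set (plane * plane) :=
  [set y | y.1.1 ^+ 2 + y.1.2 ^+ 2 <= 1 /\
    y.2.1 ^+ 2 + y.2.2 ^+ 2 = (1 - (y.1.1 ^+ 2 + y.1.2 ^+ 2)) ^+ 2].

(** With [D] the depth, [w + 2 * v1] is [3 * D] inside the ball and [D] outside, so its sign tells
    the region. There [z ^ 2] is recovered from [w - v1] or from [w + v1], and its sign from [v2].
    Outside, [r] is the squared norm of the inverted point, 0 only at infinity. *)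
Definition page_coord_inv (y : plane * plane) : S3 :=
  let w := 1 - (y.1.1 ^+ 2 + y.1.2 ^+ 2) in
  if 0 <= w + 2 * y.2.1
  then Some (y.1, Num.sg y.2.2 * Num.sqrt ((w - y.2.1) * (2 / 3)))
  else let z := Num.sg y.2.2 * Num.sqrt (2 * (w + y.2.1)) in
       let r := y.1.1 ^+ 2 + y.1.2 ^+ 2 + z ^+ 2 in
       if r == 0 then None else Some ((y.1.1 / r, y.1.2 / r), z / r).

Lemma norm2_ge0 q : 0 <= norm2 q.
Proof. by rewrite !addr_ge0// sqr_ge0. Qed.

Lemma max_norm2_gt0 q : 0 < Num.max 1 (norm2 q).
Proof. by rewrite lt_max ltr01. Qed.

Lemma norm2_continuous : continuous norm2.
Proof. by rewrite /norm2; cont. Qed.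

Lemma page_coord_some_continuous : continuous (page_coord \o Some).
Proof.
have cn := norm2_continuous.
have n0 q : Num.max 1 (norm2 q) != 0 by rewrite gt_eqF// max_norm2_gt0.
rewrite /page_coord /ball_part /depth /comp /=; cont => //.
Qed.

Lemma sgr_mul_sqrt_sqr (v a : R) : v ^+ 2 <= 0 -> a = 0 -> v = a.
Proof.
by move=> h ->; apply/eqP; rewrite -sqrf_eq0 eq_le h sqr_ge0.
Qed.

(* In both regions the page coordinates satisfy [w = |D| + z^2]. *)
Lemma ball_partE q :
  1 - ((ball_part q).1.1 ^+ 2 + (ball_part q).1.2 ^+ 2) =
    `|depth q| + (ball_part q).2 ^+ 2 /\
  -1 < depth q <= 1.
Proof.
case: q => -[a b] c; rewrite /ball_part /depth /=.
have := norm2_ge0 (a, b, c); rewrite /norm2 /=; set n := a ^+ 2 + b ^+ 2 + c ^+ 2 => n0.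
have [n1|n1] := leP n 1.
  rewrite !divr1 ger0_norm ?subr_ge0//; split; last by lra.
  by rewrite /n; ring.
have n0' : 0 < n by lra.
have -> : (1 - n) / n = n^-1 - 1 by field; rewrite gt_eqF.
have n1' : n^-1 < 1 by rewrite invf_lt1.
have n1'' : 0 < n^-1 by rewrite invr_gt0.
rewrite ler0_norm; last by lra.
split; last by lra.
have -> : n^-1 = n / n ^+ 2 by field; rewrite gt_eqF.
by rewrite /n; field; rewrite -/n gt_eqF.
Qed.

Lemma page_coord_space x : page_space (page_coord x).
Proof.
case: x => [q|]; last by rewrite /page_space /=; split; [lra|ring].
have [h _] := ball_partE q; rewrite /page_space /page_coord.
move: h; case: (ball_part q) => -[a b] z; move: (depth q) => D /= h.
have z2 := sqr_ge0 z; have D0 := normr_ge0 D.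
split; first by lra.
rewrite h exprMn sqr_sqrtr; last first.
  by rewrite -lerBlDr le_max; have [|] := leP 0 D => ?; apply/orP; [left|right]; lra.
have [D1|D1] := leP 0 D.
  rewrite ger0_norm// (max_idPl _); last by lra.
  by field.
rewrite ltr0_norm// (max_idPr _); last by lra.
by field.
Qed.

Lemma page_coordK : cancel page_coord page_coord_inv.
Proof.
case=> [q|]; last first.
  rewrite /page_coord_inv /= ifF; last by lra.
  rewrite sgr0 mul0r ifT//; apply/eqP; ring.
have [] := ball_partE q; rewrite /page_coord_inv /page_coord.
have : q = ((ball_part q).1.1 * Num.max 1 (norm2 q), (ball_part q).1.2 * Num.max 1 (norm2 q),
            (ball_part q).2 * Num.max 1 (norm2 q)).
  have m0 := max_norm2_gt0 q; case: q m0 => -[a b] c m0.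
  by rewrite /ball_part /= !divfK// gt_eqF.
have : (depth q) = (1 - norm2 q) / Num.max 1 (norm2 q) by [].
have := norm2_ge0 q.
move: (depth q) (ball_part q) (norm2 q) => D [[a b] z] n n0 DE -> h /andP[D1 D1'].
rewrite /= in h *; rewrite h.
have z2 := sqr_ge0 z; have D0 := normr_ge0 D.
have m0 : 0 < Num.max 1 n by rewrite lt_max ltr01.
have sgz (r : R) : (z != 0 -> 0 < r) -> Num.sg (z * Num.sqrt r) * Num.sqrt (z ^+ 2) = z.
  move=> r0; have [->|z0] := eqVneq z 0; first by rewrite mul0r sgr0 mul0r.
  by rewrite sgrM [Num.sg (Num.sqrt _)]gtr0_sg ?sqrtr_gt0 ?r0// mulr1 sqrtr_sqr -numEsg.
have zz : z != 0 -> 0 < z ^+ 2 by move=> z0; rewrite lt_def sqrf_eq0 z0.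
have [n1|n1] := leP n 1.
  have DE' : D = 1 - n by rewrite DE (max_idPl n1) divr1.
  have D0' : 0 <= D by rewrite DE' subr_ge0.
  rewrite ?(max_idPl n1) !mulr1 (ger0_norm D0') ifT; last by lra.
  rewrite (_ : (_ - _) * (2 / 3) = z ^+ 2); last by field.
  rewrite sgz// => /zz z0; rewrite ltr_wpDl ?le_max ?mulr_ge0//.
  by rewrite mulr_gt0.
have n0' : 0 < n by lra.
have DE' : D = n^-1 - 1 by rewrite DE (max_idPr (ltW n1)); field; rewrite gt_eqF.
have D0' : D < 0 by rewrite DE' subr_lt0 invf_lt1.
rewrite ?(max_idPr (ltW n1)) (ltr0_norm D0') ifF; last by lra.
rewrite (_ : 2 * _ = z ^+ 2); last by field.
rewrite sgz; last first.
  by move=> /zz z0; rewrite ltr_wpDl ?le_max//; [apply/orP; right; lra|rewrite mulr_gt0].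
rewrite (_ : a ^+ 2 + b ^+ 2 + z ^+ 2 = n^-1); last first.
  by rewrite (ltr0_norm D0') in h; lra.
by rewrite ifF ?invrK// invr_eq0 gt_eqF.
Qed.

Lemma page_coord_invK y : page_space y -> page_coord (page_coord_inv y) = y.
Proof.
case: y => -[a b] [v1 v2]; rewrite /page_space /page_coord_inv /= => -[ab1].
set w := 1 - (a ^+ 2 + b ^+ 2) => vw.
have w0 : 0 <= w by rewrite subr_ge0.
have vv : v2 ^+ 2 = (w - v1) * (w + v1) by have := vw; lra.
have v2p := sqr_ge0 v2.
have v1w : `|v1| <= w.
  by rewrite -(@ler_sqr _ _ w) ?nnegrE// real_normK ?num_real//; lra.
have {v1w}[v1w1 v1w2] : - w <= v1 /\ v1 <= w by move: v1w; rewrite ler_norml => /andP[].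
have sgv (r s : R) : 0 <= r -> 0 <= s -> r * s = v2 ^+ 2 ->
    Num.sg v2 * Num.sqrt r * Num.sqrt s = v2.
  by move=> r0 s0 rs; rewrite -mulrA -sqrtrM// rs sqrtr_sqr -numEsg.
have sg2 (r : R) : 0 <= r -> (v2 = 0 -> r = 0) -> (Num.sg v2 * Num.sqrt r) ^+ 2 = r.
  move=> r0 h; rewrite exprMn sqr_sqrtr// sqr_sg.
  by have [/h ->|] := eqVneq v2 0; rewrite ?mulr0// mul1r.
case: ifPn => hw; last first.
  have {}hw : w + 2 * v1 < 0 by rewrite ltNge.
  have r0 : 0 <= 2 * (w + v1) by lra.
  have z2 : (Num.sg v2 * Num.sqrt (2 * (w + v1))) ^+ 2 = 2 * (w + v1).
    apply: sg2 => // v20; move: vv; rewrite v20 expr0n /= => /esym/eqP.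
    by rewrite mulf_eq0 => /orP[/eqP|/eqP]; lra.
  rewrite z2; have -> : a ^+ 2 + b ^+ 2 + 2 * (w + v1) = 1 + w + 2 * v1 by rewrite /w; ring.
  set z := _ * _ in z2 *.
  have ab0 : a ^+ 2 + b ^+ 2 = 1 - w by rewrite /w; ring.
  have a2 := sqr_ge0 a; have b2 := sqr_ge0 b.
  have r01 : 0 <= 1 + w + 2 * v1 by lra.
  have [r00|rn0] := eqVneq.
    have v10 : v1 = - w by lra.
    have w1 : w = 1 by lra.
    have v20 : v2 = 0.
      by apply/eqP; rewrite -sqrf_eq0 vv v10 subrr mulr0.
    have a0 : a = 0 by apply/eqP; rewrite -sqrf_eq0; apply/eqP; lra.
    have b0 : b = 0 by apply/eqP; rewrite -sqrf_eq0; apply/eqP; lra.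
    by rewrite a0 b0 v20 v10 w1.
  set r := 1 + w + 2 * v1 in r01 rn0 *.
  have rp : 0 < r by rewrite lt_def rn0.
  have r1 : r < 1 by rewrite /r; lra.
  have rE : a ^+ 2 + b ^+ 2 + z ^+ 2 = r by rewrite z2 /r /w; ring.
  have nE : norm2 (a / r, b / r, z / r) = r^-1.
    have -> : norm2 (a / r, b / r, z / r) = (a ^+ 2 + b ^+ 2 + z ^+ 2) / r ^+ 2.
      by rewrite /norm2 /=; field; rewrite gt_eqF.
    by rewrite rE; field; rewrite gt_eqF.
  have n1 : 1 < r^-1 by rewrite invf_gt1.
  rewrite /page_coord /ball_part /depth nE (max_idPr (ltW n1)) /= invrK !divfK//.
  have -> : (1 - r^-1) * r = r - 1 by field; rewrite gt_eqF.
  rewrite z2 (max_idPr _); last by lra.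
  congr (_, (_, _)); first by rewrite /r; lra.
  rewrite /z sgv//; first by rewrite /r; lra.
  by rewrite vv /r; field.
set z := _ * _.
have r0 : 0 <= (w - v1) * (2 / 3) by rewrite mulr_ge0; lra.
have z2 : z ^+ 2 = (w - v1) * (2 / 3).
  apply: sg2 => // v20; move: vv; rewrite v20 expr0n /= => /esym/eqP.
  by rewrite mulf_eq0 => /orP[/eqP|/eqP]; lra.
have nE : norm2 (a, b, z) = 1 - (w + 2 * v1) / 3.
  by rewrite /norm2 /= z2 /w; field.
have n1 : norm2 (a, b, z) <= 1 by rewrite nE; lra.
rewrite /page_coord /ball_part /depth (max_idPl n1) /= !divr1 nE z2.
rewrite (max_idPl _); last by lra.
congr (_, (_, _)); first by lra.
rewrite /z sgv//; first by lra.
by rewrite vv; field.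
Qed.

Lemma page_coord_continuous : continuous page_coord.
Proof.
case=> [q|]; first by move=> W /page_coord_some_continuous.
pose G (u : space * R) : plane * plane :=
  (u.1.1, (u.2 - u.1.2 ^+ 2 / 2,
           u.1.2 * Num.sqrt (Num.max (3 * u.2) (- u.2) + 3 / 4 * u.1.2 ^+ 2))).
have cG : continuous G by rewrite /G; cont.
have GE : page_coord None = G (0, 0, 0, -1).
  by rewrite /page_coord /G /= expr0n /= !mul0r subr0.
move=> W; rewrite GE => /cG /nbhs_ballP[e /= e0 eW].
have r0 : 0 < 1 + e^-1 by rewrite addr_gt0// invr_gt0.
(* Outside this box [norm2 q] exceeds [(1 + e^-1) ^ 2], so its inverse is below [e], [e ^ 2] and 1.
   Then the ball part is within [e] of 0 and the depth within [e] of -1. *)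
exists (box (1 + e^-1)); first by split; [exact: box_compact|exact: box_closed].
move=> _ [[q nq <-]|->]; last first.
  by change (W (page_coord None)); rewrite GE; apply: eW; exact: ballxx.
have rn : (1 + e^-1) ^+ 2 < norm2 q.
  rewrite ltNge; apply/negP => h; apply: nq.
  move: (1 + e^-1) r0 h => r r0; case: q => -[a b] c; rewrite /norm2 /= => h.
  have := sqr_ge0 a; have := sqr_ge0 b; have := sqr_ge0 c => c2 b2 a2.
  have le_r (u : R) : u ^+ 2 <= r ^+ 2 -> `|u| <= r.
    by move=> ur; rewrite -(@ler_sqr _ _ r) ?nnegrE ?(ltW r0)// real_normK ?num_real.
  by split; [split|]; rewrite /= in_itv /= -ler_norml; apply: le_r; lra.
have en : 1 < norm2 q * e /\ 1 < norm2 q * e ^+ 2 /\ 1 < norm2 q.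
  have e1 : (1 + e^-1) * e = 1 + e by rewrite mulrDl mul1r mulVf ?gt_eqF// addrC.
  have e1' : 0 < e^-1 by rewrite invr_gt0.
  have h1 : (1 + e^-1) ^+ 2 * e < norm2 q * e by rewrite ltr_pM2r.
  have h2 : (1 + e^-1) ^+ 2 * e ^+ 2 < norm2 q * e ^+ 2 by rewrite ltr_pM2r ?exprn_gt0.
  rewrite -exprMn e1 in h2; rewrite expr2 -mulrA e1 in h1.
  by split; [nra|split; nra].
have [h _] := ball_partE q.
have DE0 : depth q = (norm2 q)^-1 - 1.
  rewrite /depth (max_idPr (ltW en.2.2)) mulrBl divff ?mul1r// gt_eqF//.
  by have := en.2.2; lra.
change (W (G (ball_part q, depth q))).
move: h en DE0; case: (ball_part q) => -[a b] z; move: (depth q) (norm2 q) => D n /= h en DE.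
have n0 : 0 < n by have := en.2.2; lra.
have [n1 [n2 n3]] : n^-1 < e /\ n^-1 < e ^+ 2 /\ n^-1 < 1.
  have nn : n * n^-1 = 1 by rewrite divff// gt_eqF.
  have [en1 [en2 en3]] := en.
  by rewrite -(ltr_pM2l n0) nn -(ltr_pM2l n0 n^-1 (e ^+ 2)) nn -(ltr_pM2l n0 n^-1 1) nn mulr1.
have n4 : 0 < n^-1 by rewrite invr_gt0.
have D0 : D < 0 by lra.
rewrite (ltr0_norm D0) DE in h.
have := sqr_ge0 a; have := sqr_ge0 b; have := sqr_ge0 z => z2 b2 a2.
have lte (u : R) : u ^+ 2 <= n^-1 -> `|0 - u| < e.
  move=> u2; rewrite sub0r normrN -(@ltr_sqr _ _ e) ?nnegrE ?(ltW e0)//.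
  by rewrite real_normK ?num_real//; lra.
apply: eW; split; [split; [split|]|]; rewrite -ball_normE /=.
- by apply: lte; lra.
- by apply: lte; lra.
- by apply: lte; lra.
- by rewrite ler0_norm; lra.
Qed.

Lemma page_space_turn th (y : plane * plane) :
  page_space y -> page_space (y.1, turn th y.2).
Proof. by move=> [h1 h2]; split => //=; rewrite turn_norm2. Qed.

(* The rotation of the open book through the angle [th]. *)
Definition rotate_pages (th : R) (x : S3) : S3 :=
  page_coord_inv ((page_coord x).1, turn th (page_coord x).2).

Lemma page_coord_rotate th x :
  page_coord (rotate_pages th x) = ((page_coord x).1, turn th (page_coord x).2).
Proof. exact/page_coord_invK/page_space_turn/page_coord_space. Qed.

Lemma isotopic_id_rotate_pages th : isotopic_id (rotate_pages th).
Proof.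
exists (fun t => rotate_pages (t * th)); last by rewrite mul1r.
have pinj : injective page_coord := can_inj page_coordK.
apply: bijective_ambient_isotopy.
- apply: continuous_subspaceT.
  (* In page coordinates the motion is a plain rotation, visibly continuous; [page_coord] embeds the
     compact sphere, so continuity lifts. *)
  have := @continuous_lift (R * S3)%type S3 (plane * plane)%type
    (fun tx => rotate_pages (tx.1 * th) tx.2) page_coord.
  apply => //.
  + exact: S3_compact.
  + exact: page_coord_continuous.
  + have -> : page_coord \o (fun tx : R * S3 => rotate_pages (tx.1 * th) tx.2) =
        fun tx => ((page_coord tx.2).1, turn (tx.1 * th) (page_coord tx.2).2).
      by apply/funext => tx /=; rewrite page_coord_rotate.
    have c2 := continuous_compose (continuous_snd (@continuous_id (R * S3)%type))
      page_coord_continuous.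
    by apply: continuous_pair; [|apply: turn_continuous]; cont.
- move=> t _; exists (rotate_pages (- (t * th))) => x; apply: pinj.
    by rewrite !page_coord_rotate /= turnK -surjective_pairing.
  by rewrite !page_coord_rotate /= -{1}(opprK (t * th)) turnK -surjective_pairing.
- by move=> x; apply: pinj; rewrite page_coord_rotate mul0r turn0 -surjective_pairing.
Qed.

(** The half-ellipsoids [x * sqrt beta] lie in single pages: divided by [beta], the second
    coordinate depends on [x] only. *)
Lemma page_coord_sheet p x : closed_disk p -> x ^+ 2 <= 1 ->
  page_coord (Some (p, x * Num.sqrt (beta p))) =
    (p, (beta p * (1 - 3 / 2 * x ^+ 2), x * beta p * Num.sqrt (3 - 9 / 4 * x ^+ 2))).
Proof.
move=> Dp x1; have b0 := beta_ge0 p; have bE := beta_disk Dp.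
have z2 : (x * Num.sqrt (beta p)) ^+ 2 = x ^+ 2 * beta p by rewrite exprMn sqr_sqrtr.
have nE : norm2 (p, x * Num.sqrt (beta p)) = 1 - beta p * (1 - x ^+ 2).
  by rewrite /norm2 z2 /= bE; ring.
have h : 0 <= beta p * (1 - x ^+ 2) by rewrite mulr_ge0// subr_ge0.
have n1 : norm2 (p, x * Num.sqrt (beta p)) <= 1 by rewrite nE; lra.
rewrite /page_coord /ball_part /depth nE (max_idPl _); last by lra.
rewrite !divr1 z2 (max_idPl _); last by lra.
rewrite -surjective_pairing /=; congr (_, (_, _)); first by field.
rewrite (_ : _ + _ = beta p * (3 - 9 / 4 * x ^+ 2)); last by field.
rewrite sqrtrM//; move: (Num.sqrt (3 - _)) => u.
transitivity (x * Num.sqrt (beta p) ^+ 2 * u); first ring.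
by rewrite sqr_sqrtr.
Qed.

(** Opposite pages: [1 - 3 / 2 * x ^ 2] changes sign exactly when the squares add up to [4 / 3], and
    the other coordinate requires opposite signs of [x] and [y]. *)
Lemma rotate_pages_sheet p x y : closed_disk p ->
  x ^+ 2 <= 1 -> y ^+ 2 <= 1 -> x ^+ 2 + y ^+ 2 = 4 / 3 -> x * y <= 0 ->
  rotate_pages pi (Some (p, x * Num.sqrt (beta p))) = Some (p, y * Num.sqrt (beta p)).
Proof.
move=> Dp x1 y1 xy xy0; apply: (can_inj page_coordK).
rewrite page_coord_rotate !page_coord_sheet// /turn /= cospi sinpi.
rewrite oppr0 !mul0r addr0 add0r !mulN1r; congr (_, (_, _)).
  by rewrite -mulrN; congr (_ * _); lra.
have sq (a b : R) : a ^+ 2 + b ^+ 2 = 4 / 3 -> Num.sqrt (3 - 9 / 4 * a ^+ 2) = 3 / 2 * `|b|.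
  move=> ab; rewrite (_ : _ - _ = (3 / 2 * b) ^+ 2); last by rewrite exprMn; lra.
  by rewrite sqrtr_sqr normrM ger0_norm.
rewrite (sq _ _ xy) (sq y x); last by rewrite addrC.
have key : x * `|y| = - (y * `|x|).
  have [x0|x0] := leP 0 x; have [y0|y0] := leP 0 y.
  - by rewrite ?(ger0_norm x0) ?(ger0_norm y0); have := mulr_ge0 x0 y0; lra.
  - by rewrite ?(ger0_norm x0) ?(ltr0_norm y0); ring.
  - by rewrite ?(ltr0_norm x0) ?(ger0_norm y0); ring.
  - by have := mulr_gt0 (_ : 0 < - x) (_ : 0 < - y); rewrite !oppr_gt0 => /(_ x0 y0); lra.
transitivity (- (beta p * (3 / 2) * (x * `|y|))); first ring.
by rewrite key; ring.
Qed.

Lemma stack_sqrt s (x : nat -> R) :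
  (forall i j, (i < j < s)%N -> x j < x i) ->
  stack s (fun i p => x i * Num.sqrt (beta p)).
Proof.
move=> xlt; split.
- by move=> i _; cont; exact: beta_continuous.
- by move=> i p _ Dp; rewrite beta_eq0// sqrtr0 mulr0.
- by move=> i j p ij Dp; rewrite ltr_pM2r ?sqrtr_gt0 ?beta_gt0// xlt.
Qed.

(* Half a turn of the open book: the pages with angle in (pi / 3, 2 pi / 3] and
   their opposites stay in the unit ball. *)
Lemma top_to_bottom s (pg : 'I_6 -> 'I_6 -> nat) :
  (forall a b, pg a b < s)%N ->
  ambient_isotopic (level_graph (fun a b => - (pg a b)%:R : R))
    (level_graph (fun a b => - (if pg a b == 0 then s else pg a b)%:R)).
Proof.
move=> pgs.
have s0 : (0 < s)%N by apply: leq_ltn_trans (pgs ord0 ord0).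
(* An increasing sequence in [[0, 1)], giving room for any number of pages. *)
pose e (i : nat) : R := 1 - i.+1%:R^-1.
have e0 i : 0 <= e i by rewrite subr_ge0 invf_le1 ?ltr0n// ler1n.
have e1 i : e i < 1 by rewrite ltrBlDr ltrDl invr_gt0 ltr0n.
have elt i j : (i < j)%N -> e i < e j.
  by move=> ij; rewrite ltrD2l ltrN2 ltf_pV2 ?posrE ?ltr0n// ltr_nat ltnS.
(* The top page gets a positive parameter and all others negative ones; [y] lists the opposite
   pages, with squares adding up to [4 / 3]. After the turn the former top page is the only one
   below. *)
pose x i := if i == 0 then Num.sqrt (2 / 3) else - Num.sqrt (1 / 3 + 2 / 3 * e i).
pose y i := if i == s then - Num.sqrt (2 / 3) else Num.sqrt (1 - 2 / 3 * e i).
pose pg' a b := if pg a b == 0 then s else pg a b.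
have lev n : forall i j, (i < j < n)%N -> - j%:R < - i%:R :> R.
  by move=> i j /andP[ij _]; rewrite ltrN2 ltr_nat.
apply: (@ambient_isotopic_trans _ _ (graph_over (fun a b p => x (pg a b) * Num.sqrt (beta p)))).
  apply: (@stack_graph_over _ s (fun i p => - i%:R * beta p)
    (fun i p => x i * Num.sqrt (beta p))) => //; first exact/stack_beta/lev.
  apply: stack_sqrt => i [|j] /andP[ij _] //; rewrite /x /=.
  case: eqP => [_|_]; last first.
    by rewrite ltrN2 ltr_sqrt; [have := elt _ _ ij; lra|have := e0 j.+1; lra].
  apply: (@lt_le_trans _ _ 0); last exact: sqrtr_ge0.
  by rewrite oppr_lt0 sqrtr_gt0; have := e0 j.+1; lra.
apply: (@ambient_isotopic_trans _ _ (graph_over (fun a b p => y (pg' a b) * Num.sqrt (beta p)))); last first.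
  apply: (@stack_graph_over _ s.+1 (fun i p => y i * Num.sqrt (beta p))
    (fun i p => - i%:R * beta p) pg'); last 1 first.
  - by move=> a b; rewrite /pg'; case: ifP => // _; rewrite ltnS ltnW.
  - apply: stack_sqrt => i j /andP[ij]; rewrite ltnS => js; rewrite /y.
    rewrite (ltn_eqF (leq_trans ij js)); have := e0 i; have := e1 i => ei1 ei0.
    have si : 0 < Num.sqrt (1 - 2 / 3 * e i) by rewrite sqrtr_gt0; lra.
    case: eqP => _; first by apply: lt_trans si; rewrite oppr_lt0 sqrtr_gt0; lra.
    by rewrite ltr_sqrt; [have := elt _ _ ij; lra|lra].
  - exact/stack_beta/lev.
apply/ambient_isotopicP; exists (rotate_pages pi), 1%g; split.
  exact: isotopic_id_rotate_pages.
have rot i p : (i < s)%N -> closed_disk p ->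
    rotate_pages pi (Some (p, x i * Num.sqrt (beta p))) =
    Some (p, y (if i == 0 then s else i) * Num.sqrt (beta p)).
  move=> ils Dp; have ei0 := e0 i; have ei1 := e1 i; apply: rotate_pages_sheet => //;
    rewrite /x /y; have [i0|i0] := eqVneq i 0%N; rewrite ?eqxx ?(ltn_eqF ils) ?sqrrN.
  - by rewrite sqr_sqrtr; lra.
  - by rewrite sqr_sqrtr; lra.
  - by rewrite sqr_sqrtr; lra.
  - by rewrite sqr_sqrtr; lra.
  - by rewrite !sqr_sqrtr; lra.
  - by rewrite !sqr_sqrtr; lra.
  - by rewrite mulrN oppr_le0 mulr_ge0// sqrtr_ge0.
  - by rewrite mulNr oppr_le0 mulr_ge0// sqrtr_ge0.
split=> [i|a b ab].
  have Dv : closed_disk (plane_vertex R i) by rewrite /closed_disk /= plane_vertex_circle.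
  by have := rot 0 _ s0 Dv; rewrite perm1 beta_vertex sqrtr0 !mulr0.
rewrite !perm1 /= image_comp; apply: eq_imagel => p Cp /=.
by rewrite rot//; exact: chord_disk Cp.
Qed.

End open_book.

(** * An isotopy of space that interchanges the vertices 5 and 6 *)

Section swap.
Variable R : realType.
Local Notation S3 := (one_point_compactification (R * R * R)).
Local Notation space := (R * R * R)%type.
Local Notation plane := (R * R)%type.
Local Notation k := (half_sqrt3 R).

(** The shift does not depend on the coordinate it changes, so it is undone by its negative; the
    bound by the height gives the estimate at infinity. *)
Lemma isotopic_id_shear (g : R * R -> R) :
  continuous g -> (forall v, `|g v| <= `|v.2|) ->
  isotopic_id (omap (fun q : space =>
    ((q.1.1 + g (q.1.2, q.2), q.1.2), q.2)) : S3 -> S3).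
Proof.
move=> cg gz; pose F t (q : space) := ((q.1.1 + t * g (q.1.2, q.2), q.1.2), q.2).
have -> : (fun q : space => ((q.1.1 + g (q.1.2, q.2), q.1.2), q.2)) = F 1.
  by apply/funext => q; rewrite /F mul1r.
apply: (@isotopic_id_omap _ F 2 0) => //.
- have cg' : continuous (fun x : R * space => g (x.2.1.2, x.2.2)).
    by apply: (@continuous_compose _ _ _ (fun x : R * space => (x.2.1.2, x.2.2))) cg; cont.
  by rewrite /F; cont.
- by move=> t _; exists (F (- t)) => -[[x y] z]; rewrite /F /= mulNr ?addrK ?subrK.
- by move=> [[x y] z]; rewrite /F mul0r addr0.
- move=> t [[x y] z] /andP[t0 t1]; rewrite addr0 /F /= !prod_normE /=.
  have := gz (y, z); set w := g _ => /= wz.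
  set m := Num.max (Num.max `|x + t * w| `|y|) `|z|.
  have h : `|t * w| <= `|z| by rewrite normrM (ger0_norm t0) -[leRHS]mul1r ler_pM.
  have m1 : `|x + t * w| <= m by rewrite /m !le_max lexx.
  have m2 : `|y| <= m by rewrite /m !le_max lexx orbT.
  have m3 : `|z| <= m by rewrite /m !le_max lexx orbT.
  have xm : `|x| <= 2 * m.
    by rewrite -[x in leLHS](addrK (t * w)) (le_trans (ler_normB _ _))//; lra.
  have z0 := normr_ge0 z.
  by rewrite !ge_max xm /=; apply/andP; split; lra.
Qed.

(* Points of the plane with coordinates adapted to the hexagon: the vertices have
   [X] in (1/2)Z and [u] in {-1, 0, 1}. *)
Definition hexpt (X u : R) : plane := (X, u * k).

Lemma hexpt_chord (a b : 'I_6) (t : R) :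
  (1 - t) *: plane_vertex R a + t *: plane_vertex R b =
  hexpt ((1 - t) * ((vx a)%:~R / 2) + t * ((vx b)%:~R / 2))
        ((1 - t) * (vy a)%:~R + t * (vy b)%:~R).
Proof.
rewrite !plane_vertexE /hexpt [LHS]surjective_pairing /= /GRing.scale /=.
by congr pair; ring.
Qed.

Lemma beta_hexpt X u : X ^+ 2 + 3 / 4 * u ^+ 2 <= 1 ->
  beta (hexpt X u) = 1 - (X ^+ 2 + 3 / 4 * u ^+ 2).
Proof.
move=> h; have kk := half_sqrt3_sqr R.
have e : (hexpt X u).1 ^+ 2 + (hexpt X u).2 ^+ 2 = X ^+ 2 + 3 / 4 * u ^+ 2.
  by rewrite /= exprMn kk; ring.
by rewrite beta_disk ?e// /closed_disk /= e.
Qed.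

Definition lift_height (p : plane) : R :=
  - 24 * (Num.max (-1) (Num.min 1 p.1)) * clamp (p.2 / k).

(** On the edge 24, where [u = t - 1], this is [3 * t * (1 - t)], the value of [beta]. So that edge,
    at a level in [[-1, 1]], is not moved. *)
Definition dead_zone (u : R) : R := Num.max 0 (- 3 * (u * (1 + u))).

(** A piecewise linear function of [z] that vanishes up to the dead zone and is the identity beyond
    twice the dead zone. *)
Definition slide (u z : R) : R :=
  Num.max (Num.min z 0) (Num.min 0 (2 * (z + dead_zone u))) +
  Num.min (Num.max z 0) (Num.max 0 (2 * (z - dead_zone u))).

(* After the translation by [lift_height] the vertices 5 and 6 are at heights 12
   and -12, and the edges at these vertices are straight: there the shear is
   linear, and it exchanges the projections of the two vertices. *)
Definition swap_map (q : space) : space :=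
  let z1 := q.2 + lift_height q.1 in
  let p := (q.1.1 + slide (q.1.2 / k) z1 / 12, q.1.2) in
  (p, z1 + lift_height p).

Lemma clamp_ge0 x : 0 <= clamp x :> R.
Proof. by rewrite /clamp le_max lexx. Qed.

Lemma clamp_le1 x : clamp x <= 1 :> R.
Proof. by rewrite /clamp ge_max ler01 /= ge_min lexx. Qed.

Lemma dead_zone_ge0 u : 0 <= dead_zone u.
Proof. by rewrite /dead_zone le_max lexx. Qed.

Lemma slide_le u z : `|slide u z| <= `|z|.
Proof.
have := dead_zone_ge0 u; rewrite /slide; move: (dead_zone u) => d d0.
have [z0|z0] := leP 0 z.
  rewrite (min_idPl (_ : 0 <= 2 * (z + d))) ?maxxx ?add0r; last by lra.
  set w := Num.max 0 _; have w0 : 0 <= w by rewrite le_max lexx.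
  have zw : 0 <= Num.min z w by rewrite le_min z0.
  by rewrite (ger0_norm zw) (ger0_norm z0) ge_min lexx.
rewrite (max_idPl (_ : 2 * (z - d) <= 0)) ?minxx ?addr0; last by lra.
set w := Num.min 0 _; have w0 : w <= 0 by rewrite ge_min lexx.
have zw : Num.max z w <= 0 by rewrite ge_max w0 ltW.
by rewrite (ler0_norm zw) (ltr0_norm z0) lerN2 le_max lexx.
Qed.

Lemma slide0 u z : `|z| <= dead_zone u -> slide u z = 0.
Proof.
rewrite ler_norml /slide => /andP[h1 h2]; have := dead_zone_ge0 u => d0.
rewrite (min_idPl (_ : 0 <= 2 * (z + dead_zone u))); last by lra.
rewrite (max_idPl (_ : 2 * (z - dead_zone u) <= 0)); last by lra.
rewrite (max_idPr _) ?ge_min ?lexx ?orbT// (min_idPr _) ?le_max ?lexx ?orbT//.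
by rewrite addr0.
Qed.

Lemma slide_id u z : 2 * dead_zone u <= `|z| -> slide u z = z.
Proof.
rewrite /slide; have := dead_zone_ge0 u; move: (dead_zone u) => d d0.
have [z0|z0] := leP 0 z => h.
  rewrite ger0_norm// in h.
  rewrite (min_idPl (_ : 0 <= 2 * (z + d))); last by lra.
  rewrite (max_idPr (_ : 0 <= 2 * (z - d))); last by lra.
  by rewrite maxxx (min_idPl (_ : z <= 2 * (z - d))) ?add0r; lra.
rewrite ltr0_norm// in h.
rewrite (min_idPr (_ : 2 * (z + d) <= 0)); last by lra.
rewrite (max_idPl (_ : 2 * (z - d) <= 0)); last by lra.
by rewrite minxx (max_idPl (_ : 2 * (z + d) <= z)) ?addr0; lra.
Qed.

Lemma slide_continuous : continuous (fun v : R * R => slide (v.1 / k) v.2).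
Proof. by rewrite /slide /dead_zone /clamp; cont. Qed.

Lemma lift_height_continuous : continuous lift_height.
Proof. by rewrite /lift_height /clamp; cont. Qed.

Lemma isotopic_id_swap : isotopic_id (omap swap_map : S3 -> S3).
Proof.
have pl : pushable (fun q : space => lift_height q.1).
  apply: pushable_translation; first exact: lift_height_continuous.
  exists 24 => p; rewrite /lift_height.
  have h : `|- 24 * Num.max (-1) (Num.min 1 p.1)| <= 24.
    rewrite normrM normrN (ger0_norm (_ : 0 <= 24))// -[leRHS]mulr1 ler_pM2l// ler_norml.
    by rewrite le_max lexx /= ge_max ge_min lexx; lra.
  by rewrite normrM -[leRHS]mulr1 ler_pM// clamp_norm.
have sh := @isotopic_id_shear (fun v => slide (v.1 / k) v.2 / 12).
have {}sh : isotopic_id (omap (fun q : space =>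
    ((q.1.1 + slide (q.1.2 / k) q.2 / 12, q.1.2), q.2)) : S3 -> S3).
  apply: sh; first by have := slide_continuous => ?; cont.
  move=> v; rewrite normrM (le_trans _ (slide_le (v.1 / k) v.2))// ler_piMr//.
  by rewrite ger0_norm ?invr_ge0// invf_le1// ler1n.
have := isotopic_id_comp (isotopic_id_comp (isotopic_id_push pl) sh) (isotopic_id_push pl).
by congr isotopic_id; apply/funext => -[[[x y] z]|].
Qed.

End swap.

(** * The interchange followed along each edge *)

Section star_exchange.
Variable R : realType.
Local Notation S3 := (one_point_compactification (R * R * R)).
Local Notation space := (R * R * R)%type.
Local Notation plane := (R * R)%type.
Local Notation k := (half_sqrt3 R).

Lemma clamp_id (x : R) : 0 <= x <= 1 -> clamp x = x.
Proof. by move=> /andP[x0 x1]; rewrite /clamp (min_idPr x1) (max_idPr x0). Qed.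

Lemma swap_case (X u z z1 X' u' z' c : R) :
  u' = u -> clamp u = c -> -1 <= X <= 1 -> -1 <= X' <= 1 -> z1 = z - 24 * X * c ->
  [\/ - dead_zone u <= z1 <= dead_zone u /\ X' = X,
      2 * dead_zone u <= z1 /\ X' = X + z1 / 12 |
      z1 <= - (2 * dead_zone u) /\ X' = X + z1 / 12] ->
  z' = z1 - 24 * X' * c ->
  swap_map (hexpt X u, z) = (hexpt X' u', z').
Proof.
move=> -> cE /andP[X0 X1] /andP[X0' X1'] z1E H z'E.
have k0 := half_sqrt3_gt0 R.
have lE Y : -1 <= Y -> Y <= 1 -> lift_height (hexpt Y u) = - 24 * Y * c.
  move=> Y0 Y1; rewrite /lift_height /hexpt /= mulfK ?gt_eqF// cE.
  by rewrite (min_idPr Y1) (max_idPr Y0).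
rewrite /swap_map /= lE// mulfK ?gt_eqF//.
have -> : z + - 24 * X * c = z1 by rewrite z1E; ring.
have -> : X + slide u z1 / 12 = X'.
  case: H => [[zd ->]|[zd ->]|[zd ->]].
  - by rewrite slide0 ?mul0r ?addr0// ler_norml.
  - have d0 := dead_zone_ge0 u.
    by rewrite slide_id// ger0_norm//; lra.
  - have d0 := dead_zone_ge0 u.
    by rewrite slide_id// ler0_norm//; lra.
have := lE X' X0' X1'; rewrite /hexpt => ->.
by congr pair; rewrite z'E; ring.
Qed.

Lemma swap_case_eq (X u z z1 X' z' c X0 u0 z0 X0' u0' z0' : R) :
  X0 = X -> u0 = u -> z0 = z -> X0' = X' -> u0' = u -> z0' = z' ->
  clamp u = c -> -1 <= X <= 1 -> -1 <= X' <= 1 -> z1 = z - 24 * X * c ->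
  [\/ - dead_zone u <= z1 <= dead_zone u /\ X' = X,
      2 * dead_zone u <= z1 /\ X' = X + z1 / 12 |
      z1 <= - (2 * dead_zone u) /\ X' = X + z1 / 12] ->
  z' = z1 - 24 * X' * c ->
  swap_map (hexpt X0 u0, z0) = (hexpt X0' u0', z0').
Proof. by move=> -> -> -> -> -> ->; apply: swap_case. Qed.

Definition hexX (a b : nat) (t : R) : R := (1 - t) * ((vx a)%:~R / 2) + t * ((vx b)%:~R / 2).
Definition hexU (a b : nat) (t : R) : R := (1 - t) * (vy a)%:~R + t * (vy b)%:~R.

Lemma beta_param (a b : 'I_6) (t : R) : 0 <= t <= 1 ->
  beta (hexpt (hexX a b t) (hexU a b t)) = t * (1 - t) *
    ((((vx a)%:~R - (vx b)%:~R) / 2) ^+ 2 + 3 / 4 * ((vy a)%:~R - (vy b)%:~R) ^+ 2).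
Proof.
move=> t01; rewrite /hexX /hexU -hexpt_chord beta_disk; last first.
  by apply: (@chord_disk _ a b); exists t.
have := plane_vertex_circle R a; have := plane_vertex_circle R b.
have ke (r : R) : (r * k) ^+ 2 = r ^+ 2 * (3 / 4) by rewrite exprMn (half_sqrt3_sqr R).
rewrite hexpt_chord !plane_vertexE /hexpt /circle /= !ke => hb ha.
apply/eqP; rewrite -subr_eq0; apply/eqP.
transitivity ((1 - t) * (1 - (((vx a)%:~R / 2) ^+ 2 + (vy a)%:~R ^+ 2 * (3 / 4))) +
  t * (1 - (((vx b)%:~R / 2) ^+ 2 + (vy b)%:~R ^+ 2 * (3 / 4)))); first by field.
by rewrite ha hb; ring.
Qed.

(** [bend] is for the long diagonals at 5 and 6, that is 25 and 36, and [tilt] for 35 and 26. The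
    minimum with 1 keeps the values in a bounded positive range over the whole plane. *)
Definition bend (u : R) : R := 6 * (1 + 2 * clamp u) / (1 + Num.min 1 `|u|).
Definition tilt (u : R) : R := 8 / (1 + Num.min 1 `|u|).

(* The levels of the edges at the vertices 5 and 6 become straight after the
   translation by [lift_height]. *)
Lemma bend_beta (t : R) : 0 <= t <= 1 ->
  bend (2 * t - 1) * (4 * (t * (1 - t))) = 12 * t - 12 * (2 * t - 1) * clamp (2 * t - 1).
Proof.
move=> /andP[t0 t1]; rewrite /bend; have [h|h] := leP 0 (2 * t - 1).
  rewrite clamp_id; last by lra.
  rewrite ger0_norm// (min_idPr (_ : 2 * t - 1 <= 1)); last by lra.
  by field; lra.
rewrite clamp0 ?ltW// ltr0_norm// (min_idPr (_ : - (2 * t - 1) <= 1)); last by lra.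
by field; lra.
Qed.

Lemma tilt_beta (t : R) : 0 <= t <= 1 ->
  tilt (2 * t - 1) * (3 * (t * (1 - t))) = 12 * t - 12 * clamp (2 * t - 1).
Proof.
move=> /andP[t0 t1]; rewrite /tilt; have [h|h] := leP 0 (2 * t - 1).
  rewrite clamp_id; last by lra.
  rewrite ger0_norm// (min_idPr (_ : 2 * t - 1 <= 1)); last by lra.
  by field; lra.
rewrite clamp0 ?ltW// ltr0_norm// (min_idPr (_ : - (2 * t - 1) <= 1)); last by lra.
by field; lra.
Qed.

Lemma dead_zone_pos u : 0 <= u -> dead_zone u = 0 :> R.
Proof. by move=> u0; apply/max_idPl; rewrite mulNr oppr_le0 mulr_ge0// mulr_ge0// addr_ge0. Qed.

Lemma dead_zone_star (t : R) : 0 <= t <= 1 -> 2 * dead_zone (2 * t - 1) <= 12 * t.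
Proof.
move=> /andP[t0 t1]; have h := mulr_ge0 t0 t0.
have -> : 12 * t = 2 * (6 * t) by ring.
by rewrite ler_pM2l// ge_max; apply/andP; split; lra.
Qed.

Lemma dead_zone_side (t : R) : 0 <= t <= 1 -> dead_zone (t - 1) = 3 * (t * (1 - t)).
Proof.
move=> /andP[t0 t1]; have h : 0 <= t * (1 - t) by rewrite mulr_ge0// subr_ge0.
by rewrite /dead_zone (max_idPr _); lra.
Qed.

(** The sign [s] decides which star is on top. The parameters [g1], [g2] belong to 25, 35, then
    [h1], [h2] to 26, 36, and [e] to 24. On 15, 45, 16 and 46 the constants 12 and -12 already
    become straight after the lift. *)
Definition star_levels (s e : R) (g1 g2 h1 h2 : plane -> R) (a b : nat) (p : plane) : R :=
  let i := minn a b in let j := maxn a b in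
  if j == 4%N then s * nth 0 [:: 12; g1 p; g2 p; - 12] i
  else if j == 5%N then s * nth 0 [:: 12; h1 p; h2 p; - 12; 0] i
  else if (i == 1%N) && (j == 3%N) then e else 0.

Definition bent_star (s e : R) :=
  star_levels s e (fun p => bend (p.2 / k)) (fun p => tilt (p.2 / k))
    (fun p => - tilt (p.2 / k)) (fun p => - bend (p.2 / k)).

Definition v5 : 'I_6 := @Ordinal 6 4 isT.
Definition v6 : 'I_6 := @Ordinal 6 5 isT.

Lemma swap_edge (e t : R) (a b : 'I_6) : -1 <= e <= 1 -> 0 <= t <= 1 -> (a < b)%N ->
  let a' := tperm v5 v6 a in let b' := tperm v5 v6 b in
  let p := hexpt (hexX a b t) (hexU a b t) in
  let p' := hexpt (hexX a' b' t) (hexU a' b' t) in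
  swap_map (p, bent_star 1 e a b p * beta p) = (p', bent_star (-1) e a' b' p' * beta p').
Proof.
move=> e1 t01 ab a' b' p p'; have k0 := half_sqrt3_gt0 R.
have [t0 t1] : 0 <= t /\ t <= 1 by apply/andP.
have tt : 0 <= t * (1 - t) by rewrite mulr_ge0// subr_ge0.
have B1 := bend_beta t01; have T1 := tilt_beta t01.
have cl := clamp_ge0 (2 * t - 1); have cl1 := clamp_le1 (2 * t - 1).
have d1 := dead_zone_star t01; have d2 := dead_zone_side t01.
have d3 := dead_zone_pos t0; have d4 := dead_zone_pos (@ler01 R).
have c3 := clamp_id t01; have c4 : clamp 1 = 1 :> R by apply: clamp_id; rewrite ler01 lexx.
rewrite /p /p' !beta_param//.
have pv u : u * k / k = u by rewrite mulfK ?gt_eqF.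
rewrite /bent_star /star_levels /= !pv {pv}.
have tp i : tperm v5 v6 i = (if i == 4%N :> nat then v6 else if i == 5%N :> nat then v5 else i).
  by case: tpermP => [->|->|/eqP+ /eqP]; rewrite //= -!val_eqE /= => /negbTE -> /negbTE ->.
rewrite /a' /b' {a' b' p p'} !tp {tp}.
have Eu : (1 - t) * (-1)%:~R + t * 1%:~R = 2 * t - 1 by lra.
set C := clamp (2 * t - 1) in B1 T1 cl cl1.
case: a b ab => -[|[|[|[|[|[|//]]]]]] // ? [[|[|[|[|[|[|//]]]]]] // ?] // _ /=;
  rewrite /hexX /hexU /vx /vy /=;
  rewrite ?Eu.
(* One case for each pair [a < b] in lexicographic order. The arguments are the point [X], [u] of
   the edge, its height [z], its height [z1] after the lift, the new abscissa [X'], the final height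
   and the clamp of [u]. On edges from the vertices 1 to 4 to vertex 5 or 6, [z1] is [12 * t] or
   [- 12 * t]. *)
- apply: (@swap_case_eq (1 - t / 2) (- t) (0) (0) (1 - t / 2) (0) (0)); [lra|lra|lra|lra|lra|lra|by apply: clamp0; lra|lra|lra|lra|apply: Or31; split => //; rewrite oppr_le0 andbb; exact: dead_zone_ge0|lra].
- apply: (@swap_case_eq (1 - 3 / 2 * t) (- t) (0) (0) (1 - 3 / 2 * t) (0) (0)); [lra|lra|lra|lra|lra|lra|by apply: clamp0; lra|lra|lra|lra|apply: Or31; split => //; rewrite oppr_le0 andbb; exact: dead_zone_ge0|lra].
- apply: (@swap_case_eq (1 - 2 * t) (0) (0) (0) (1 - 2 * t) (0) (0)); [lra|lra|lra|lra|lra|lra|by apply: clamp0; lra|lra|lra|lra|apply: Or31; split => //; rewrite oppr_le0 andbb; exact: dead_zone_ge0|lra].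
- apply: (@swap_case_eq (1 - 3 / 2 * t) (t) (36 * (t * (1 - t))) (12 * t) (1 - t / 2) (- 12 * (t * (1 - t))) (t)); [lra|lra|lra|lra|lra|lra|exact: c3|lra|lra|lra|apply: Or32; rewrite d3; lra|lra].
- apply: (@swap_case_eq (1 - t / 2) (t) (12 * (t * (1 - t))) (- 12 * t) (1 - 3 / 2 * t) (- 36 * (t * (1 - t))) (t)); [lra|lra|lra|lra|lra|lra|exact: c3|lra|lra|lra|apply: Or33; rewrite d3; lra|lra].
- apply: (@swap_case_eq (1 / 2 - t) (-1) (0) (0) (1 / 2 - t) (0) (0)); [lra|lra|lra|lra|lra|lra|by apply: clamp0; lra|lra|lra|lra|apply: Or31; split => //; rewrite oppr_le0 andbb; exact: dead_zone_ge0|lra].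
- apply: (@swap_case_eq (1 / 2 - 3 / 2 * t) (t - 1) (e * (3 * (t * (1 - t)))) (e * (3 * (t * (1 - t)))) (1 / 2 - 3 / 2 * t) (e * (3 * (t * (1 - t)))) (0)); [lra|lra|lra|lra|lra|lra|by apply: clamp0; lra|lra|lra|lra|apply: Or31; rewrite d2; split => //; nra|lra].
- apply: (@swap_case_eq (1 / 2 - t) ((2 * t - 1)) ((12 * t - 12 * (2 * t - 1) * C)) (12 * t) (1 / 2) ((12 * t - 12 * C)) (C)); [lra|lra|lra|lra|lra|lra|by []|lra|lra|lra|apply: Or32; lra|lra].
- apply: (@swap_case_eq (1 / 2) ((2 * t - 1)) (- (12 * t - 12 * C)) (- 12 * t) (1 / 2 - t) (- (12 * t - 12 * (2 * t - 1) * C)) (C)); [lra|lra|lra|lra|lra|lra|by []|lra|lra|lra|apply: Or33; lra|lra].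
- apply: (@swap_case_eq (- 1 / 2 - t / 2) (t - 1) (0) (0) (- 1 / 2 - t / 2) (0) (0)); [lra|lra|lra|lra|lra|lra|by apply: clamp0; lra|lra|lra|lra|apply: Or31; split => //; rewrite oppr_le0 andbb; exact: dead_zone_ge0|lra].
- apply: (@swap_case_eq (- 1 / 2) ((2 * t - 1)) ((12 * t - 12 * C)) (12 * t) (- 1 / 2 + t) ((12 * t - 12 * (2 * t - 1) * C)) (C)); [lra|lra|lra|lra|lra|lra|by []|lra|lra|lra|apply: Or32; lra|lra].
- apply: (@swap_case_eq (- 1 / 2 + t) ((2 * t - 1)) (- (12 * t - 12 * (2 * t - 1) * C)) (- 12 * t) (- 1 / 2) (- (12 * t - 12 * C)) (C)); [lra|lra|lra|lra|lra|lra|by []|lra|lra|lra|apply: Or33; lra|lra].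
- apply: (@swap_case_eq (- 1 + t / 2) (t) (- 12 * (t * (1 - t))) (12 * t) (- 1 + 3 / 2 * t) (36 * (t * (1 - t))) (t)); [lra|lra|lra|lra|lra|lra|exact: c3|lra|lra|lra|apply: Or32; rewrite d3; lra|lra].
- apply: (@swap_case_eq (- 1 + 3 / 2 * t) (t) (- 36 * (t * (1 - t))) (- 12 * t) (- 1 + t / 2) (12 * (t * (1 - t))) (t)); [lra|lra|lra|lra|lra|lra|exact: c3|lra|lra|lra|apply: Or33; rewrite d3; lra|lra].
- apply: (@swap_case_eq (- 1 / 2 + t) (1) (0) (12 - 24 * t) (1 / 2 - t) (0) (1)); [lra|lra|lra|lra|lra|lra|exact: c4|lra|lra|lra|rewrite d4; by have [h|h] := leP 0 (1 - 2 * t); [apply: Or32|apply: Or33]; lra|lra].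
Qed.

End star_exchange.

(** * The interchange as an equivalence, and straightening the star levels *)

Section star_exchange_levels.
Variable R : realType.
Local Notation S3 := (one_point_compactification (R * R * R)).
Local Notation space := (R * R * R)%type.
Local Notation plane := (R * R)%type.
Local Notation k := (half_sqrt3 R).

Lemma chord_sym (a b : 'I_6) : @chord R a b = chord b a.
Proof.
have H c d : @chord R c d `<=` chord d c.
  move=> p [t /=]; rewrite in_itv /= => t01 <-; exists (1 - t).
    by rewrite /= in_itv /=; lra.
  by rewrite (_ : 1 - (1 - t) = t); [rewrite addrC|ring].
by apply/seteqP; split; exact: H.
Qed.

Lemma star_levels_sym (s e : R) g1 g2 h1 h2 (a b : nat) (p : plane) :
  star_levels s e g1 g2 h1 h2 a b p = star_levels s e g1 g2 h1 h2 b a p.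
Proof. by rewrite /star_levels minnC maxnC. Qed.

Lemma swap_bent_star (e : R) : -1 <= e <= 1 ->
  ambient_isotopic (coef_graph (fun a b => bent_star 1 e a b))
                   (coef_graph (fun a b => bent_star (-1) e a b)).
Proof.
move=> e1; apply/ambient_isotopicP; exists (omap (@swap_map R)), (tperm v5 v6).
split; first exact: isotopic_id_swap.
have h0 (a b : 'I_6) : plane_vertex R a = hexpt (hexX a b (0 : R)) (hexU a b (0 : R)).
  by rewrite /hexX /hexU -hexpt_chord subr0 scale1r scale0r addr0.
have h1 (a b : 'I_6) : plane_vertex R b = hexpt (hexX a b (1 : R)) (hexU a b (1 : R)).
  by rewrite /hexX /hexU -hexpt_chord subrr scale1r scale0r add0r.
(* The images of the vertices are read off at the ends of edges: [i] starts the edge to vertex 6,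
   and vertex 6 ends the edge from vertex 1. *)
split=> [i|a b ab].
  have [i5|i5] := ltnP i 5.
    have := @swap_edge R e 0 i v6 e1 _ i5; rewrite lexx ler01 => /(_ isT).
    by cbv zeta; rewrite -!h0 !beta_vertex !mulr0 => E; rewrite /= E.
  have -> : i = v6 by apply/val_inj/eqP; rewrite /= eqn_leq i5 andbT -ltnS ltn_ord.
  have := @swap_edge R e 1 ord0 v6 e1 _ isT; rewrite lexx ler01 => /(_ isT).
  by cbv zeta; rewrite -!h1 !beta_vertex !mulr0 => E; rewrite /= E.
have H (c d : 'I_6) : (c < d)%N ->
    omap (@swap_map R) @` edge (coef_graph (fun a b => bent_star 1 e a b)) c d =
    edge (coef_graph (fun a b => bent_star (-1) e a b)) (tperm v5 v6 c) (tperm v5 v6 d).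
  move=> cd; apply/seteqP; split=> [_ [_ [_ [t t01 <-] <-] <-]|_ [_ [t t01 <-] <-]].
    have := t01; rewrite /= in_itv /= => t01'.
    rewrite !hexpt_chord (swap_edge e1 t01' cd); cbv zeta.
    exists (hexpt (hexX (tperm v5 v6 c) (tperm v5 v6 d) t)
                  (hexU (tperm v5 v6 c) (tperm v5 v6 d) t)) => //.
    by exists t => //; rewrite hexpt_chord.
  have := t01; rewrite /= in_itv /= => t01'.
  exists (Some (hexpt (hexX c d t) (hexU c d t),
    bent_star 1 e c d (hexpt (hexX c d t) (hexU c d t)) *
    beta (hexpt (hexX c d t) (hexU c d t)))); last first.
    by rewrite [LHS]/= (swap_edge e1 t01' cd) hexpt_chord.
  exists (hexpt (hexX c d t) (hexU c d t)) => //.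
  by exists t => //; rewrite hexpt_chord.
have [ltab|ltba|/val_inj ab'] := ltngtP a b; first exact: H.
  have sym s c d : edge (coef_graph (fun a b => bent_star s e a b)) c d =
      edge (coef_graph (fun a b => bent_star s e a b)) d c.
    rewrite /= chord_sym; apply: eq_imagel => p _.
    by rewrite /bent_star star_levels_sym.
  by rewrite sym H// sym.
by rewrite ab' eqxx in ab.
Qed.

(** Edges with a common endpoint do not cross, so no diagonal of the star of 5 occurs among the
    levels met by the edges 25 and 35. *)
Lemma cross_v5 (s e : R) g1 g2 h1 h2 (p : plane) (c a b : 'I_6) : (0 < c < 3)%N ->
  edges_cross a b c v5 -> star_levels s e g1 g2 h1 h2 a b p \in
    [:: 0; e; s * h1 p; s * h2 p; s * - 12].
Proof.
rewrite edges_crossE; case: c => -[|[|[|//]]] // ? _;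
  case: a => -[|[|[|[|[|[|//]]]]]] // ?; case: b => -[|[|[|[|[|[|//]]]]]] // ? // _;
  by rewrite /star_levels !inE /= eqxx ?orbT.
Qed.

Lemma cross_v6 (s e : R) g1 g2 h1 h2 (p : plane) (c a b : 'I_6) : (0 < c < 3)%N ->
  edges_cross a b c v6 -> star_levels s e g1 g2 h1 h2 a b p \in
    [:: 0; e; s * g1 p; s * g2 p; s * 12].
Proof.
rewrite edges_crossE; case: c => -[|[|[|//]]] // ? _;
  case: a => -[|[|[|[|[|[|//]]]]]] // ?; case: b => -[|[|[|[|[|[|//]]]]]] // ? // _;
  by rewrite /star_levels !inE /= eqxx ?orbT.
Qed.

(** The bound 1 dominates the levels 0 and [e] of the edges outside the stars, and 19 exceeds both
    12 and all values of [bend] and [tilt]. *)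
Definition star_range (g : plane -> R) := continuous g /\ forall p, 1 < g p < 19.

Lemma move_star_levels (s e : R) (g1 g2 h1 h2 g1' g2' h1' h2' : plane -> R) :
  s = 1 \/ s = -1 -> -1 <= e <= 1 ->
  star_range g1 -> star_range g2 -> star_range h1 -> star_range h2 ->
  star_range g1' -> star_range g2' -> star_range h1' -> star_range h2' ->
  ambient_isotopic
    (coef_graph (fun a b => star_levels s e g1 g2 (fun p => - h1 p) (fun p => - h2 p) a b))
    (coef_graph (fun a b => star_levels s e g1' g2' (fun p => - h1' p) (fun p => - h2' p) a b)).
Proof.
move=> sE e1 [cg1 rg1] [cg2 rg2] [ch1 rh1] [ch2 rh2] [cg1' rg1'] [cg2' rg2'] [ch1' rh1'] [ch2' rh2'].
(* The sign [sg] treats edges of the upper and the lower star alike: the window is from 1 to 19 or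
   from -19 to -1. *)
have step (c d : 'I_6) (r r' : plane -> R) (F F' : 'I_6 -> 'I_6 -> plane -> R) (sg : R) :
    sg = 1 \/ sg = -1 -> c != d ->
    continuous r -> (forall p, 1 < r p < 19) -> continuous r' -> (forall p, 1 < r' p < 19) ->
    (forall a b, (a, b) = (c, d) \/ (a, b) = (d, c) ->
       F a b = (fun p => sg * r p) /\ F' a b = (fun p => sg * r' p)) ->
    (forall a b, (a, b) != (c, d) -> (a, b) != (d, c) -> F' a b = F a b) ->
    (forall a b p, edges_cross a b c d -> sg * F a b p <= 1) ->
    ambient_isotopic (coef_graph F) (coef_graph F').
  move=> sgE cd cr rr cr' rr' FE FF' Fx.
  case: sgE => sgE; subst sg.
    apply: (@move_edge R c d F F' (fun p => 1 * r p) (fun p => 1 * r' p) 1 19) => //.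
    - by cont.
    - by cont.
    - by move=> p; rewrite mul1r.
    - by move=> p; rewrite mul1r.
    - by move=> a b p X _; left; have := Fx a b p X; rewrite mul1r.
  apply: (@move_edge R c d F F' (fun p => -1 * r p) (fun p => -1 * r' p) (-19) (-1)) => //.
  - by cont.
  - by cont.
  - by move=> p; have := rr p; lra.
  - by move=> p; have := rr' p; lra.
  - by move=> a b p X _; right; have := Fx a b p X; lra.
have rangeN (h : plane -> R) : (fun p => s * - h p) = (fun p => - s * h p).
  by apply/funext => p; ring.
have sN : - s = 1 \/ - s = -1 by case: sE => ->; [right|left]; rewrite ?opprK.
apply: (@ambient_isotopic_trans _ _ (coef_graph (fun a b =>
  star_levels s e g1' g2 (fun p => - h1 p) (fun p => - h2 p) a b))).
  apply: (step (@Ordinal 6 1 isT) v5 g1 g1' _ _ s) => //.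
  - by move=> a b [] [-> ->].
  - by clear; case=> -[|[|[|[|[|[|//]]]]]] // ? [[|[|[|[|[|[|//]]]]]] // ?] //.
  - move=> a b p /(@cross_v5 s e g1 g2 (fun p => - h1 p) (fun p => - h2 p) p (@Ordinal 6 1 isT) a b isT); have := rh1 p; have := rh2 p => r1 r2.
    rewrite !inE; case: sE => ->; case/or4P => [/eqP->|/eqP->|/eqP->|/orP[/eqP->|/eqP->]]; lra.
apply: (@ambient_isotopic_trans _ _ (coef_graph (fun a b =>
  star_levels s e g1' g2' (fun p => - h1 p) (fun p => - h2 p) a b))).
  apply: (step (@Ordinal 6 2 isT) v5 g2 g2' _ _ s) => //.
  - by move=> a b [] [-> ->].
  - by clear; case=> -[|[|[|[|[|[|//]]]]]] // ? [[|[|[|[|[|[|//]]]]]] // ?] //.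
  - move=> a b p /(@cross_v5 s e g1' g2 (fun p => - h1 p) (fun p => - h2 p) p (@Ordinal 6 2 isT) a b isT); have := rh1 p; have := rh2 p => r1 r2.
    rewrite !inE; case: sE => ->; case/or4P => [/eqP->|/eqP->|/eqP->|/orP[/eqP->|/eqP->]]; lra.
apply: (@ambient_isotopic_trans _ _ (coef_graph (fun a b =>
  star_levels s e g1' g2' (fun p => - h1' p) (fun p => - h2 p) a b))).
  apply: (step (@Ordinal 6 1 isT) v6 h1 h1' _ _ (- s)) => //.
  - by move=> a b [] [-> ->]; rewrite -!rangeN.
  - by clear; case=> -[|[|[|[|[|[|//]]]]]] // ? [[|[|[|[|[|[|//]]]]]] // ?] //.
  - move=> a b p /(@cross_v6 s e g1' g2' (fun p => - h1 p) (fun p => - h2 p) p (@Ordinal 6 1 isT) a b isT); have := rg1' p; have := rg2' p => r1 r2.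
    rewrite !inE; case: sE => ->; case/or4P => [/eqP->|/eqP->|/eqP->|/orP[/eqP->|/eqP->]]; lra.
  apply: (step (@Ordinal 6 2 isT) v6 h2 h2' _ _ (- s)) => //.
  - by move=> a b [] [-> ->]; rewrite -!rangeN.
  - by clear; case=> -[|[|[|[|[|[|//]]]]]] // ? [[|[|[|[|[|[|//]]]]]] // ?] //.
  - move=> a b p /(@cross_v6 s e g1' g2' (fun p => - h1' p) (fun p => - h2 p) p (@Ordinal 6 2 isT) a b isT); have := rg1' p; have := rg2' p => r1 r2.
    rewrite !inE; case: sE => ->; case/or4P => [/eqP->|/eqP->|/eqP->|/orP[/eqP->|/eqP->]]; lra.
Qed.

End star_exchange_levels.

(** * Acyclic orientations of the crossing graph and the finite computation *)

Definition diagonals : seq (nat * nat) :=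
  [:: (0, 2); (0, 3); (0, 4); (1, 3); (1, 4); (1, 5); (2, 4); (2, 5); (3, 5)]%N.

(* Pairs of indices in [diagonals]. *)
Definition crossings : seq (nat * nat) :=
  [:: (0, 3); (0, 4); (0, 5); (1, 4); (1, 5); (1, 6); (1, 7); (2, 5); (2, 7); (2, 8);
      (3, 6); (3, 7); (4, 7); (4, 8); (6, 8)]%N.

Definition diagonal_index (a b : nat) : nat := index (minn a b, maxn a b) diagonals.

(* A level for each diagonal; sides of the hexagon get the level 0. *)
Definition lv (l : seq nat) (a b : nat) : nat := nth 0%N l (diagonal_index a b).

Lemma lv_sym l a b : lv l a b = lv l b a.
Proof. by rewrite /lv /diagonal_index minnC maxnC. Qed.

Definition ordered_like (x y x' y' : nat) : bool :=
  ((x < y) && (x' < y') || (y < x) && (y' < x'))%N.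

(** In particular [same_order_seq l l] says that crossing diagonals have different levels, and it is
    used below as the properness condition. *)
Definition same_order_seq (l l' : seq nat) : bool :=
  all (fun ij => ordered_like (nth 0%N l ij.1) (nth 0%N l ij.2)
                              (nth 0%N l' ij.1) (nth 0%N l' ij.2)) crossings.

Lemma cross_index (a b c d : 'I_6) : edges_cross a b c d ->
  ((diagonal_index a b, diagonal_index c d) \in crossings) ||
  ((diagonal_index c d, diagonal_index a b) \in crossings).
Proof.
have H : ord6_all (fun a => ord6_all (fun b => ord6_all (fun c => ord6_all (fun d =>
  nat_cross a b c d ==> ((diagonal_index a b, diagonal_index c d) \in crossings) ||
  ((diagonal_index c d, diagonal_index a b) \in crossings))))) by vm_compute.
have := ord6_allP d (ord6_allP c (ord6_allP b (ord6_allP a H))).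
by rewrite edges_crossE => /implyP.
Qed.

Lemma same_order_seqP l l' : same_order_seq l l' -> same_order (lv l) (lv l').
Proof.
move=> /allP H a b c d /cross_index /orP[] /H; rewrite /ordered_like /lv //=.
by rewrite orbC.
Qed.

Definition source (l : seq nat) (i : nat) : bool :=
  all (fun jm => ((jm.1 == i) ==> (nth 0%N l jm.2 < nth 0%N l jm.1)%N) &&
                 ((jm.2 == i) ==> (nth 0%N l jm.1 < nth 0%N l jm.2)%N)) crossings.

Definition flip (l : seq nat) (i : nat) : seq nat :=
  set_nth 0%N [seq x.+1 | x <- l] i 0%N.

(* Flipping sources other than the diagonal 14 leads to the representative of the
   class in which 14 is the only source. *)
Fixpoint nf (n : nat) (l : seq nat) : seq nat :=
  if n is n'.+1 then
    if [seq i <- [:: 0; 2; 3; 4; 5; 6; 7; 8]%N | source l i] is i :: _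
    then nf n' (flip l i) else l
  else l.

Definition rot_levels (l : seq nat) : seq nat :=
  [seq lv l ((e.1 + 5) %% 6) ((e.2 + 5) %% 6) | e <- diagonals].

(* All diagonals at 5 at the top and those at 6 at the bottom, or conversely; the
   other ones cross only in the pair 13, 24. *)
Definition nat_star (up over : bool) (a b : nat) : nat :=
  let i := minn a b in let j := maxn a b in
  (if j == 4 then (if (i == 3) (+) up then 24 else 0)
   else if j == 5 then (if i == 4 then 12 else if (i == 0) (+) ~~ up then 24 else 0)
   else if (i == 1) && (j == 3) then (if over then 11 else 13) else 12)%N.

Definition star_seq up over : seq nat := [seq nat_star up over e.1 e.2 | e <- diagonals].

(** The two configurations on three levels are mirror images of each other up to a cyclic
    permutation of the levels. In [four_levels] the level is 3 minus the index of the sheet, counted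
    from 0. *)
Definition three_levels1 : seq nat := [:: 0; 0; 1; 1; 1; 2; 2; 2; 0]%N.
Definition three_levels2 : seq nat := [:: 0; 0; 2; 2; 2; 1; 1; 1; 0]%N.
Definition four_levels : seq nat := [:: 3; 3; 2; 2; 0; 1; 0; 1; 3]%N.
Definition four_levels_mirror : seq nat := [:: 0; 0; 1; 1; 3; 2; 3; 2; 0]%N.

Definition targets := [:: three_levels1; three_levels2; four_levels; four_levels_mirror].

Definition rotated_nf (l : seq nat) : seq (seq nat) :=
  [seq nf 40 (iter k rot_levels l) | k <- iota 0 6].

Definition target_nfs : seq (seq nat) :=
  Eval vm_compute in flatten [seq rotated_nf t | t <- targets].

Definition star_nfs : seq (seq nat) :=
  Eval vm_compute in flatten [seq rotated_nf (star_seq b b) | b <- [:: true; false]].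

Definition reduces_to (s : seq (seq nat)) (l : seq nat) : bool :=
  has (same_order_seq (nf 40 l)) s.

(** Crossings are listed with the smaller index first, so a new colour need only be compared with
    those already chosen. This prunes the search in [colorings_all]. *)
Definition compatible (l : seq nat) (c : nat) : bool :=
  all (fun ij => (ij.2 == size l) ==> (nth 0%N l ij.1 != c)) crossings.

Fixpoint colorings_all (n : nat) (P : seq nat -> bool) (l : seq nat) : bool :=
  if n is n'.+1 then
    all (fun c => if compatible l c then colorings_all n' P (rcons l c) else true) (iota 0 4)
  else P l.

Lemma colorings_allP (n : nat) (P : seq nat -> bool) (l s : seq nat) :
  size s = n -> all (fun c => c < 4)%N s ->
  (forall ij, ij \in crossings -> ij.2 < size (l ++ s) ->
     nth 0 (l ++ s) ij.1 != nth 0 (l ++ s) ij.2)%N ->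
  colorings_all n P l -> P (l ++ s).
Proof.
elim: n l s => [|n IHn] l [|c s] // sz; first by rewrite cats0.
case: sz => sn /andP[c4 s4] H C.
have /allP/(_ c) : all (fun c => if compatible l c
  then colorings_all n P (rcons l c) else true) (iota 0 4) := C.
rewrite mem_iota => /(_ c4).
rewrite -cat_rcons in H *; rewrite ifT; first exact: IHn.
apply/allP => -[i j] ijX /=; apply/implyP => /eqP jl.
have ij : (i < j)%N.
  have /allP H0 : all (fun ij => ij.1 < ij.2)%N crossings by [].
  exact: H0 ijX.
have := H _ ijX; rewrite /= !nth_cat !size_rcons jl ltnSn size_cat size_rcons.
rewrite addSn ltnS leq_addr => /(_ isT).
by rewrite !nth_rcons ltnn eqxx -jl (leq_trans ij (leqnSn _)) ij.
Qed.

Lemma all_colorings_reduce :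
  colorings_all 9 (reduces_to (target_nfs ++ star_nfs)) [::].
Proof. by vm_compute. Qed.

(** * The combinatorial moves as isotopies *)

Section level_lists.
Variable R : realType.
Local Notation space := (R * R * R)%type.
Local Notation plane := (R * R)%type.
Local Notation k := (half_sqrt3 R).

Lemma shift_level_graph (c : R) (x y : 'I_6 -> 'I_6 -> R) :
  (forall a b, a != b -> y a b = x a b + c) ->
  ambient_isotopic (level_graph x) (level_graph y).
Proof.
move=> xy; apply: (@push_graph_over _ (fun q : space => c * beta q.1)).
- apply: (@pushable_translation _ (fun p => c * beta p)).
    by cont; exact: beta_continuous.
  apply: bounded_off_disk; first by cont; exact: beta_continuous.
  by move=> p /beta_eq0 ->; rewrite mulr0.
- by move=> i; rewrite /= beta_vertex mulr0.
- by move=> a b p ab _ /=; rewrite xy// mulrDl.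
Qed.

(** After a shift by 12 the two stars lie at levels 12 and -12, and their edges can be bent within
    the free windows. *)
Lemma nat_star_bent (up over : bool) :
  ambient_isotopic (level_graph (fun a b => (nat_star up over a b)%:R : R))
    (coef_graph (fun a b => bent_star (if up then 1 else -1 : R) (if over then -1 else 1) a b)).
Proof.
apply: (@ambient_isotopic_trans _ _ (coef_graph (fun a b : 'I_6 => star_levels (if up then 1 else -1 : R)
  (if over then -1 else 1) (fun=> 12) (fun=> 12) (fun=> - 12) (fun=> - 12) a b))).
  apply: (@ambient_isotopic_trans _ _ (level_graph (fun a b : 'I_6 => star_levels (if up then 1 else -1 : R)
    (if over then -1 else 1) (fun=> 12) (fun=> 12) (fun=> - 12) (fun=> - 12) a b 0))).
    apply: (shift_level_graph (c := - 12)) => a b.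
    case: a b => -[|[|[|[|[|[|//]]]]]] // ? [[|[|[|[|[|[|//]]]]]] // ?] // _;
      rewrite /nat_star /star_levels /=; case: up; case: over => /=; lra.
  by apply: eq_coef_graph => a b p _.
have range12 : @star_range R (fun=> 12).
  by split; [exact: continuous_cst|move=> p; lra].
have u1 (u : R) : 0 <= Num.min 1 `|u| <= 1.
  by rewrite le_min ler01 normr_ge0 ge_min lexx.
have rbend : @star_range R (fun p => bend (p.2 / k)).
  split.
    rewrite /bend /clamp; cont => p.
    by apply: lt0r_neq0; have := u1 (p.2 / k); lra.
  move=> p; rewrite /bend; have := u1 (p.2 / k); set m := Num.min _ _ => m1.
  have c0 := clamp_ge0 (p.2 / k); have c1 := clamp_le1 (p.2 / k).
  have m0 : 0 < 1 + m by lra.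
  by rewrite ltr_pdivlMr// ltr_pdivrMr//; lra.
have rtilt : @star_range R (fun p => tilt (p.2 / k)).
  split.
    rewrite /tilt; cont => p.
    by apply: lt0r_neq0; have := u1 (p.2 / k); lra.
  move=> p; rewrite /tilt; have := u1 (p.2 / k); set m := Num.min _ _ => m1.
  have m0 : 0 < 1 + m by lra.
  by rewrite ltr_pdivlMr// ltr_pdivrMr//; lra.
apply: (@move_star_levels R _ _ (fun=> 12) (fun=> 12) (fun=> 12) (fun=> 12)) => //.
  by case: up; [left|right].
by case: over; lra.
Qed.

Lemma star_exchange (up over : bool) :
  ambient_isotopic (level_graph (fun a b => (nat_star up over a b)%:R : R))
                   (level_graph (fun a b => (nat_star (~~ up) over a b)%:R)).
Proof.
have e1 : -1 <= (if over then -1 else 1 : R) <= 1 by case: over; lra.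
have H := swap_bent_star e1.
apply: ambient_isotopic_trans (nat_star_bent up over) _.
apply: ambient_isotopic_trans (ambient_isotopic_sym (nat_star_bent (~~ up) over)).
by case: up => /=; [exact: H|exact: ambient_isotopic_sym].
Qed.

Definition list_graph (l : seq nat) := level_graph (fun a b => (lv l a b)%:R : R).

Lemma same_order_list_graph l l' :
  same_order_seq l l' -> ambient_isotopic (list_graph l) (list_graph l').
Proof.
move=> /same_order_seqP ll'; apply: same_order_isotopic => // a b;
  exact: lv_sym.
Qed.

Lemma flip_list_graph l i : source l i -> same_order_seq l l -> (i < 9)%N -> size l = 9%N ->
  ambient_isotopic (list_graph l) (list_graph (flip l i)).
Proof.
move=> /[dup] li /allP liP /[dup] ll /allP llP i9 l9.
pose M := (\max_(x <- l) x).+1.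
have lM j : (nth 0%N l j < M)%N.
  have [jl|jl] := ltnP j (size l); last by rewrite nth_default.
  by rewrite ltnS; apply: (@leq_bigmax_seq _ _ xpredT id) => //; exact: mem_nth.
have lvM l' j : nth 0%N (set_nth 0%N l' j M) j = M by rewrite nth_set_nth /= eqxx.
(* A source may be raised alone to a level above all others, so that it fills the top page; [y] is
   the result of sending that page to the bottom. *)
pose l1 := set_nth 0%N l i M.
pose y a b := if lv l1 a b == M then 0%N else (lv l1 a b).+1.
have l1M a b : (lv l1 a b <= M)%N.
  by rewrite /lv nth_set_nth /=; case: eqP => // _; exact: ltnW.
have yE (a b : 'I_6) : y a b = if diagonal_index a b == i then 0%N else (lv l a b).+1.
  rewrite /y /lv nth_set_nth /=; have [_|_] := eqVneq (diagonal_index a b) i.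
    by rewrite eqxx.
  by rewrite ltn_eqF.
apply: (@ambient_isotopic_trans _ _ (list_graph l1)).
  apply: same_order_list_graph; apply/allP => -[a b] X.
  have := liP _ X; have := llP _ X; rewrite /ordered_like /= !nth_set_nth /=.
  have [->|ai] := eqVneq a i; have [->|bi] := eqVneq b i => //=.
  - by rewrite ltnn.
  - by rewrite andbT lM => _ ->; rewrite orbT.
  - by rewrite lM => _ ->.
apply: (@ambient_isotopic_trans _ _ (level_graph (fun a b => (y a b)%:R))).
  pose pg (a b : 'I_6) := (M - lv l1 a b)%N.
  apply: (@ambient_isotopic_trans _ _ (level_graph (fun a b => - (pg a b)%:R))).
    by apply: (shift_level_graph (c := - M%:R)) => a b _; rewrite natrB//; lra.
  apply: ambient_isotopic_trans (@top_to_bottom _ M.+1 pg _) _.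
    by move=> a b; rewrite ltnS leq_subr.
  apply: (shift_level_graph (c := M.+1%:R)) => a b _.
  rewrite /pg /y subn_eq0 eqn_leq l1M /=; case: ifP => _; first by lra.
  by rewrite natrB// -!natr1; lra.
apply: same_order_isotopic.
- by move=> a b; rewrite /y lv_sym.
- by move=> a b; exact: lv_sym.
have flE (a b : 'I_6) : (diagonal_index a b < 9)%N -> lv (flip l i) a b = y a b.
  move=> ab; rewrite yE /lv /flip nth_set_nth /=; case: eqP => // _.
  by rewrite (nth_map 0%N) ?l9.
move=> a b c d X.
have [ab cd] : (diagonal_index a b < 9)%N /\ (diagonal_index c d < 9)%N.
  have H : all (fun ij => (ij.1 < 9) && (ij.2 < 9))%N crossings by [].
  by case/orP: (cross_index X) => /(allP H)/andP[].
rewrite !flE// !yE.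
have H : forall j m, (j, m) \in crossings ->
    ordered_like (if j == i then 0%N else (nth 0%N l j).+1) (if m == i then 0%N else (nth 0%N l m).+1)
      (if j == i then 0%N else (nth 0%N l j).+1) (if m == i then 0%N else (nth 0%N l m).+1).
  move=> j m jm; have := liP _ jm; have := llP _ jm; rewrite /ordered_like /=.
  have [->|ji] := eqVneq j i; have [->|mi] := eqVneq m i => //=; rewrite ?ltnn ?orbT //.
by case/orP: (cross_index X) => /H; rewrite /ordered_like // orbC.
Qed.

End level_lists.

(** * Reduction of every colouring to a target *)

Section reduction.
Variable R : realType.

Lemma nth_flip l i j : size l = 9%N -> (j < 9)%N ->
  nth 0%N (flip l i) j = if j == i then 0%N else (nth 0%N l j).+1.
Proof.
by move=> l9 j9; rewrite /flip nth_set_nth /=; case: eqP => // _; rewrite (nth_map 0%N) ?l9.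
Qed.

Lemma size_flip l i : size l = 9%N -> (i < 9)%N -> size (flip l i) = 9%N.
Proof. by move=> l9 i9; rewrite /flip size_set_nth size_map l9; apply/maxn_idPr. Qed.

Lemma crossings_lt9 ij : ij \in crossings -> (ij.1 < 9)%N /\ (ij.2 < 9)%N.
Proof.
have /allP H : all (fun ij => (ij.1 < 9) && (ij.2 < 9))%N crossings by [].
by move=> /H /andP.
Qed.

Lemma flip_proper l i : source l i -> same_order_seq l l -> size l = 9%N ->
  same_order_seq (flip l i) (flip l i).
Proof.
move=> /allP liP /allP llP l9; apply/allP => -[j m] X.
have [/= j9 m9] := crossings_lt9 X; rewrite !nth_flip//.
have := liP _ X; have := llP _ X; rewrite /ordered_like /=.
by have [->|ji] := eqVneq j i; have [->|mi] := eqVneq m i => //=; rewrite ?ltnn ?orbT.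
Qed.

Lemma nfS n l : nf n.+1 l =
  if [seq i <- [:: 0; 2; 3; 4; 5; 6; 7; 8]%N | source l i] is i :: _
  then nf n (flip l i) else l.
Proof. by []. Qed.

Lemma nf_list_graph n l : same_order_seq l l -> size l = 9%N ->
  ambient_isotopic (list_graph R l) (list_graph R (nf n l)).
Proof.
elim: n l => [|n IHn] l ll l9; first exact: same_order_list_graph.
rewrite nfS.
case E: [seq i <- [:: 0; 2; 3; 4; 5; 6; 7; 8]%N | source l i] => [|i s].
  exact: same_order_list_graph.
have : i \in [seq i <- [:: 0; 2; 3; 4; 5; 6; 7; 8]%N | source l i] by rewrite E mem_head.
rewrite mem_filter => /andP[li i9'].
have i9 : (i < 9)%N.
  by have /allP/(_ _ i9') : all (fun i => i < 9)%N [:: 0; 2; 3; 4; 5; 6; 7; 8]%N by [].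
apply: ambient_isotopic_trans (flip_list_graph R li ll i9 l9) _.
by apply: IHn; [exact: flip_proper|exact: size_flip].
Qed.

Lemma rot_list_graph l : size l = 9%N ->
  ambient_isotopic (list_graph R l) (list_graph R (rot_levels l)).
Proof.
case: l => [|? [|? [|? [|? [|? [|? [|? [|? [|? [|//]]]]]]]]]] // _.
apply: rotate_level_graph => a b; congr (_%:R).
by case: a b => -[|[|[|[|[|[|//]]]]]] ? [[|[|[|[|[|[|//]]]]]] ?].
Qed.

Lemma star_list_graph up over :
  ambient_isotopic (list_graph R (star_seq up over)) (list_graph R (star_seq (~~ up) over)).
Proof.
have H u o : ambient_isotopic (list_graph R (star_seq u o))
    (level_graph (fun a b => (nat_star u o a b)%:R)).
  apply: (@same_order_isotopic R (fun a b => lv (star_seq u o) a b) (fun a b => nat_star u o a b)).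
  - by move=> a b; exact: lv_sym.
  - by move=> a b; rewrite /nat_star minnC maxnC.
  - move=> a b c d; rewrite edges_crossE.
    have C : ord6_all (fun a => ord6_all (fun b => ord6_all (fun c => ord6_all (fun d =>
      nat_cross a b c d ==> ordered_like (lv (star_seq u o) a b) (lv (star_seq u o) c d)
        (nat_star u o a b) (nat_star u o c d))))).
      by case: u; case: o; vm_compute.
    have := ord6_allP d (ord6_allP c (ord6_allP b (ord6_allP a C))).
    by move=> /implyP.
apply: ambient_isotopic_trans (H up over) _.
apply: ambient_isotopic_trans (star_exchange R up over) _.
exact/ambient_isotopic_sym/H.
Qed.

Definition rotatable (t : seq nat) : bool :=
  all (fun n => let l := iter n rot_levels t in same_order_seq l l && (size l == 9%N))
    (iota 0 6).

Lemma rotated_nf_list_graph t m : rotatable t -> m \in rotated_nf t ->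
  ambient_isotopic (list_graph R t) (list_graph R m).
Proof.
move=> /allP rt /mapP[n]; rewrite mem_iota /= add0n => n6 ->.
have ok j : (j < 6)%N -> same_order_seq (iter j rot_levels t) (iter j rot_levels t) /\
    size (iter j rot_levels t) = 9%N.
  by move=> j6; have := rt j; rewrite mem_iota => /(_ j6) /andP[? /eqP].
have [on sn] := ok n n6.
apply: ambient_isotopic_trans (nf_list_graph 40 on sn).
elim: n n6 {on sn} => [|n IHn] n6; first by apply: same_order_list_graph; case: (ok 0%N isT).
apply: ambient_isotopic_trans (IHn (ltnW n6)) _.
by apply: rot_list_graph; case: (ok n (ltnW n6)).
Qed.

Lemma rotatable_targets : all rotatable targets.
Proof. by vm_compute. Qed.

Lemma rotatable_stars : all (fun b => rotatable (star_seq b b)) [:: true; false].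
Proof. by vm_compute. Qed.

Lemma exchanged_stars_reduce :
  all (fun b => reduces_to target_nfs (star_seq (~~ b) b) &&
    (same_order_seq (star_seq (~~ b) b) (star_seq (~~ b) b))) [:: true; false].
Proof. by vm_compute. Qed.

Lemma target_nfsE : target_nfs = flatten [seq rotated_nf t | t <- targets].
Proof. by vm_compute. Qed.

Lemma star_nfsE : star_nfs = flatten [seq rotated_nf (star_seq b b) | b <- [:: true; false]].
Proof. by vm_compute. Qed.

Lemma reduces_to_target l : same_order_seq l l -> size l = 9%N ->
  reduces_to target_nfs l ->
  exists2 t, t \in targets & ambient_isotopic (list_graph R l) (list_graph R t).
Proof.
move=> ll l9 /hasP[m]; rewrite target_nfsE => /flatten_mapP[t tT mt] lm.
exists t => //; apply: ambient_isotopic_trans (nf_list_graph 40 ll l9) _.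
apply: ambient_isotopic_trans (same_order_list_graph R lm) _.
apply: ambient_isotopic_sym; apply: rotated_nf_list_graph mt.
exact: (allP rotatable_targets).
Qed.

(** If the normal form is that of a rotated star, go back to the star itself, exchange the vertices
    5 and 6, and reduce again. *)
Lemma coloring_reduces_to_target l : same_order_seq l l -> size l = 9%N ->
  all (fun c => c < 4)%N l ->
  exists2 t, t \in targets & ambient_isotopic (list_graph R l) (list_graph R t).
Proof.
move=> ll l9 l4.
have : reduces_to (target_nfs ++ star_nfs) l.
  rewrite -[l]cat0s; apply: (colorings_allP l9 l4 _ all_colorings_reduce).
  move=> ij X _ /=; have := allP ll _ X; rewrite /ordered_like.
  by case: ltngtP.
rewrite /reduces_to has_cat => /orP[|/hasP[m]]; first exact: reduces_to_target.
rewrite star_nfsE => /flatten_mapP[b bT mt] lm.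
have /andP[r p] := allP exchanged_stars_reduce _ bT.
have [t tT bt] := reduces_to_target p erefl r.
exists t => //; apply: ambient_isotopic_trans bt.
apply: ambient_isotopic_trans (star_list_graph b b).
apply: ambient_isotopic_trans (nf_list_graph 40 ll l9) _.
apply: ambient_isotopic_trans (same_order_list_graph R lm) _.
apply: ambient_isotopic_sym; apply: rotated_nf_list_graph mt.
exact: (allP rotatable_stars).
Qed.

(** Pages are numbered from the top, levels from the bottom. Properness of [l] comes from
    [page_cross]. *)
Lemma page_levels_isotopic s (B : book R s) (l : seq nat) : size l = 9%N ->
  (forall a b : 'I_6, (diagonal_index a b < 9)%N -> lv l a b = (s.-1 - page B a b)%N) ->
  ambient_isotopic (book_graph B) (list_graph R l) /\ same_order_seq l l.
Proof.
move=> l9 lB.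
have bd (a b : 'I_6) : (page B a b <= s.-1)%N.
  by rewrite -ltnS prednK// (leq_ltn_trans _ (ltn_ord (page B a b))).
have neq (a b c d : 'I_6) : edges_cross a b c d ->
    (s.-1 - page B a b != s.-1 - page B c d)%N.
  move=> /(page_cross B); apply: contra => /eqP e; apply/eqP/val_inj.
  by rewrite -[LHS](subKn (bd a b)) e subKn.
have same : same_order (fun a b => (s.-1 - page B a b)%N) (lv l).
  move=> a b c d X; have := neq _ _ _ _ X.
  have [ab cd] : (diagonal_index a b < 9)%N /\ (diagonal_index c d < 9)%N.
    by case/orP: (cross_index X) => /crossings_lt9[].
  by rewrite !lB// andbb andbb; case: ltngtP.
split.
  apply: ambient_isotopic_trans (@book_level_graph R s B (fun i => (s.-1 - i)%:R) _) _.
    move=> i j /andP[ij js]; rewrite ltr_nat ltn_sub2l//.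
    by rewrite (leq_trans ij)// -ltnS (ltn_predK js).
  apply: same_order_isotopic same => a b; last exact: lv_sym.
  by rewrite page_sym.
apply/allP => -[i j] X; rewrite /ordered_like !andbb.
have H : all (fun ij => let e := nth (0, 0)%N diagonals ij.1 in
    let f := nth (0, 0)%N diagonals ij.2 in
    [&& (e.1 < 6)%N, (e.2 < 6)%N, (f.1 < 6)%N, (f.2 < 6)%N,
      nat_cross e.1 e.2 f.1 f.2, diagonal_index e.1 e.2 == ij.1 &
      diagonal_index f.1 f.2 == ij.2]) crossings by vm_compute.
have /and5P[a6 b6 c6 d6 /and3P[x /eqP e1 /eqP e2]] := allP H _ X.
have := same (Ordinal a6) (Ordinal b6) (Ordinal c6) (Ordinal d6).
rewrite edges_crossE => /(_ x).
rewrite /lv /= e1 e2 => /orP[] /andP[_ ->] //.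
by rewrite orbT.
Qed.

End reduction.

Lemma nth_diagonal (a b : nat) : (diagonal_index a b < 9)%N ->
  nth (0, 0)%N diagonals (diagonal_index a b) = (minn a b, maxn a b).
Proof. by move=> ab; rewrite /diagonal_index nth_index// -index_mem. Qed.

(** * Translation between books and level lists, and the theorem *)

Section books.
Variable R : realType.

Definition page_levels s (B : book R s) : seq nat :=
  [seq (s.-1 - page B (inord e.1) (inord e.2))%N | e <- diagonals].

Lemma lv_page_levels s (B : book R s) (a b : 'I_6) : (diagonal_index a b < 9)%N ->
  lv (page_levels B) a b = (s.-1 - page B a b)%N.
Proof.
move=> ab; rewrite /lv (nth_map (0, 0)%N)// nth_diagonal//=.
have [h|h] := leqP a b; first by rewrite !inord_val.
by rewrite !inord_val page_sym.
Qed.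

Lemma three_levels_book (t : seq nat) : size t = 9%N -> same_order_seq t t ->
  all (fun c => c < 3)%N t ->
  exists B : book R 3, ambient_isotopic (list_graph R t) (book_graph B).
Proof.
move=> t9 tt t3.
have lv3 a b : (lv t a b < 3)%N.
  rewrite /lv; have [h|h] := ltnP (diagonal_index a b) (size t).
    by apply: (allP t3); exact: mem_nth.
  by rewrite nth_default.
pose pg (a b : 'I_6) : 'I_3 := inord (2 - lv t a b).
have pgE a b : pg a b = (2 - lv t a b)%N :> nat by rewrite inordK// ltnS leq_subr.
have pgs a b : pg a b = pg b a by rewrite /pg lv_sym.
have pgx a b c d : edges_cross a b c d -> pg a b != pg c d.
  move=> /(same_order_seqP tt); apply: contraTneq => /(congr1 val) /=.
  rewrite !pgE => e.
  have -> : lv t a b = lv t c d.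
    by rewrite -(@subKn (lv t a b) 2) ?e ?subKn// -ltnS.
  by rewrite ltnn.
exists (paraboloid_book R pgs pgx); apply: ambient_isotopic_sym.
have [|H _] := @page_levels_isotopic R 3 (paraboloid_book R pgs pgx) t t9; last exact: H.
by move=> a b _; rewrite /= pgE subKn// -ltnS.
Qed.

(** A diagonal belongs to the list of its own page, and a finite check shows that the listing then
    forces its level. *)
Lemma four_sheets_page (T : book R 4) (a b : 'I_6) :
  has_sheets T four_sheets -> (diagonal_index a b < 9)%N ->
  lv four_levels a b = (3 - page T a b)%N /\ lv four_levels_mirror a b = page T a b.
Proof.
move=> [_ hT].
wlog ab : a b / (a < b)%N => [W|] d.
  have [ab|ba|/val_inj e] := ltngtP a b; first exact: W.
    rewrite page_sym [lv four_levels a b]lv_sym [lv four_levels_mirror a b]lv_sym.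
    by apply: W => //; rewrite /diagonal_index minnC maxnC.
  have H : ord6_all (fun a => ~~ (diagonal_index a a < 9)%N) by vm_compute.
  by have := ord6_allP a H; rewrite e in d; rewrite e d.
have E : ord6_all (fun a => ord6_all (fun b => (diagonal_index a b < 9)%N ==>
    ~~ ((a.+1 %% 6 == b) || (b.+1 %% 6 == a)))%N) by vm_compute.
have /implyP/(_ d) nx := ord6_allP b (ord6_allP a E).
have := hT (page T a b) (a.+1, b.+1).
have -> : (a.+1, b.+1) \in interior_edges T (page T a b).
  apply/mapP; exists (a, b) => //.
  by rewrite mem_filter mem_enum /= ab eqxx !andbT; exact: nx.
have K : all (fun k => ord6_all (fun a => ord6_all (fun b =>
    ((a.+1, b.+1) \in nth [::] four_sheets k) ==>
    ((lv four_levels a b == 3 - k) && (lv four_levels_mirror a b == k)))))%N (iota 0 4).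
  by vm_compute.
have Kp := allP K (page T a b).
rewrite mem_iota /= in Kp; have := ord6_allP b (ord6_allP a (Kp (ltn_ord _))).
by move=> /implyP H /esym /H /andP[/eqP -> /eqP ->].
Qed.

End books.

Theorem theorem3 (R : realType) (s : nat) (B : book R s)
    (hB : has_sheet_number B 4) (T : book R 4)
    (hT : has_sheets T four_sheets) :
  book_equiv B T \/ book_equiv B (mirror T).
Proof.
case: hB => -[B' BB'] minB.
have [|B'l ll] := @page_levels_isotopic R 4 B' (page_levels B') erefl.
  exact: lv_page_levels.
have [|t tT lt] := @coloring_reduces_to_target R _ ll erefl.
  by apply/allP => c /mapP[e _ ->]; rewrite ltnS leq_subr.
have Bt : ambient_isotopic (book_graph B) (list_graph R t).
  by apply: ambient_isotopic_trans BB' _; apply: ambient_isotopic_trans B'l lt.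
(* A target on three levels would make the book equivalent to one on three sheets. *)
have no3 : same_order_seq t t -> size t = 9%N -> all (fun c => c < 3)%N t -> False.
  move=> tt t9 t3; have [B3 tB3] := three_levels_book R t9 tt t3.
  by have := minB 3%N B3 (ambient_isotopic_trans Bt tB3).
move: tT; rewrite !inE => /or4P[] /eqP tE; rewrite {}tE in Bt no3.
- by case: no3.
- by case: no3.
- left; apply: ambient_isotopic_trans Bt _; apply: ambient_isotopic_sym.
  have [|H _] := @page_levels_isotopic R 4 T four_levels erefl; last exact: H.
  by move=> a b /(four_sheets_page hT)[].
(* Reversing pages and then turning pages into levels leaves the page number of [T] as the level. *)
- right; apply: ambient_isotopic_trans Bt _; apply: ambient_isotopic_sym.
  have [|H _] := @page_levels_isotopic R 4 (mirror T) four_levels_mirror erefl; last exact: H.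
  move=> a b /(four_sheets_page hT)[_ ->] /=.
  by rewrite subSS subKn// -ltnS.
Qed.
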